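(* Let $r\ge1$ and $q\ge r+1$ be integers and let $G_r(n)$ be a random $r$-regular graph on $n$ nodes. Then the (random) number $Z(q,G_r(n))$ of proper $q$-colorings of $G_r(n)$ satisfies $$\frac{\log Z(q,G_r(n))}{n}\longrightarrow\log\Big[q\Big(1-\frac1q\Big)^{\frac r2}\Big]$$ with high probability as $n\to\infty$.
   Context: $G_r(n)$ is chosen uniformly at random from the set of all (simple) $r$-regular graphs on $n$ labelled nodes ($n\to\infty$ along those $n$ for which $rn$ is even). $Z(q,G)$ is the number of maps from the node set of $G$ to $\{1,\dots,q\}$ giving different values to adjacent nodes. ''$X_n\to c$ with high probability'' means that for every $\delta>0$, $\mathbb{P}(|X_n-c|>\delta)\to0$ as $n\to\infty$. *)

(* Defs.v *)
From HB Require Import structures.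
From mathcomp Require Import all_boot all_order all_algebra.
From mathcomp Require Import all_classical all_reals all_analysis.

Set Implicit Arguments.
Unset Strict Implicit.
Unset Printing Implicit Defensive.

Import Order.TTheory GRing.Theory Num.Theory.
Import numFieldNormedType.Exports.

Local Open Scope classical_set_scope.
Local Open Scope ring_scope.

(* A graph on the labelled nodes 'I_n is given by its set of edges, an edge
   being the unordered pair (2-element set) of its end points. *)
Definition simple_graph (n : nat) (G : {set {set 'I_n}}) : bool :=
  [forall e in G, #|e| == 2%N].

Definition degree (n : nat) (G : {set {set 'I_n}}) (x : 'I_n) : nat :=
  #|[set e in G | x \in e]%SET|.

Definition regular_graphs (r n : nat) : {set {set {set 'I_n}}} :=
  [set G | simple_graph G && [forall x, degree G x == r]]%SET.

Definition proper_coloring (q n : nat) (G : {set {set 'I_n}})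
    (f : {ffun 'I_n -> 'I_q}) : bool :=
  [forall x, forall y, ([set x; y]%SET \in G) ==> (f x != f y)].

Definition num_colorings (q n : nat) (G : {set {set 'I_n}}) : nat :=
  #|[set f : {ffun 'I_n -> 'I_q} | proper_coloring G f]%SET|.

(* Probability of the event A for the uniformly distributed random r-regular
   graph on n nodes.  When there is no such graph (e.g. n <= r) this is 0 / 0,
   that is, 0. *)
Definition prob_regular (R : realType) (r n : nat)
    (A : pred {set {set 'I_n}}) : R :=
  #|[set G in regular_graphs r n | A G]%SET|%:R / #|regular_graphs r n|%:R.

(* X n is a random variable on the space of r-regular graphs on n nodes, and
   n tends to infinity along the integers such that r * n is even. *)
Definition cvg_whp (R : realType) (r : nat)
    (X : forall n, {set {set 'I_n}} -> R) (c : R) : Prop :=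
  forall delta : R, 0 < delta ->
    prob_regular R r (fun G : {set {set 'I_n}} => delta < `|X n G - c|)
      @[n --> within [set m : nat | ~~ odd (r * m)] \oo] --> (0 : R).

(* Main.v *)
Require Import Defs.
From HB Require Import structures.
From mathcomp Require Import all_boot all_order all_algebra.
From mathcomp Require Import all_classical all_reals all_analysis.
From mathcomp Require Import all_fingroup polyrcf ring lra zify.

Import Order.TTheory GRing.Theory Num.Theory.
Import numFieldNormedType.Exports.

Local Open Scope ring_scope.

(** Why the theorem holds.  Write [d = r - 1], [m = r n / 2] and
    [B = (q (q - 1)) ^ m / q ^ (n d)], which is the [n]-th power of
    [q (1 - 1 / q) ^ (r / 2)] (lemma [ln_bethe]).  Split every node into [r]
    half-edges, put all half-edges in a uniformly random order and join them
    two by two: this gives a random [r]-regular multigraph.  Conditioned on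
    having neither loops nor multiple edges it is the uniform [r]-regular graph
    ([prob_regular_shuffle]), and that event has probability at least an inverse
    power of [n] ([card_simple_ge]).  An event that is exponentially unlikely
    for the multigraph is therefore exponentially unlikely for the graph.  Let
    [Z] be the number of proper colourings of the multigraph.

    Second moment.  [E Z^2] is a sum over pairs of colourings.  A pair that uses
    the pair of colours [u] on a proportion [p u] of the nodes contributes, up
    to a polynomial factor and with the entropy of [p] taken into account, the
    [m]-th power of the sum of [y u * y v] over compatible [u] and [v], where
    [y = p ^ (d / r)].  Bounding this for all [p] means computing the norm from
    [l^(r/d)] to [l^r] of the adjacency operator of the tensor square of the
    complete graph [K_q].  The norm is multiplicative ([bilinear_neq2_le]), so
    it is enough to treat [K_q], where constant vectors are extremal as soon as
    [r <= q] ([bilinear_neq_le]; the crux is the one-variable inequality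
    [compl_pow_le]).  Hence [E Z^2 <= poly(n) B^2] ([second_moment]).  With
    Markov's inequality this bounds [Z] from above.

    First moment.  Colourings that use all colours equally often, on pairings
    that use all pairs of distinct colours equally often, already give
    [B <= poly(n) E Z] ([first_moment]).  By the Paley-Zygmund inequality,
    [Z >= B / poly(n)] with probability at least [1 / poly(n)].

    Concentration.  Because [q > r], adding an edge destroys at most half of the
    colourings as long as the degrees do not exceed [r]: in a colouring that
    violates the new edge, an end point of it can be recoloured.  So [ln Z],
    with loops disregarded in order to keep it finite, changes by at most [ln 4]
    when two half-edges are exchanged ([ln_loose_colorings_lip]), and a
    martingale argument gives exponential concentration around the mean
    ([shuffle_tail]).  The mean cannot be much smaller than [ln B], since
    otherwise the event of the Paley-Zygmund step would be exponentially
    unlikely.  Hence [Z] is exponentially unlikely to be much smaller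
    than [B]. *)

Set Implicit Arguments.
Unset Strict Implicit.
Unset Printing Implicit Defensive.

(** * An extremal inequality for the complete graph *)

(** The inequality between the arithmetic and the geometric mean for [d] factors
    [G] and one factor chosen so that all of them add up to [d + 1]. *)
Lemma expr_mul_tangent_le1 (R : realFieldType) (d : nat) (G : R) :
  0 <= G -> G ^+ d * (1 + d%:R * (1 - G)) <= 1.
Proof.
move=> G0; elim: d => [|d IH]; first by rewrite expr0 mul0r addr0 mulr1.
apply: le_trans IH; rewrite -subr_ge0.
have -> : G ^+ d * (1 + d%:R * (1 - G)) - G ^+ d.+1 * (1 + d.+1%:R * (1 - G))
   = (d.+1)%:R * G ^+ d * (1 - G) ^+ 2.
  by rewrite exprS -natr1; ring.
by rewrite mulr_ge0 ?sqr_ge0 // mulr_ge0 ?exprn_ge0.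
Qed.

(** The difference of the two sides of [compl_pow_le] is a polynomial [psi] that
    vanishes at [1].  Its derivative is a nonnegative factor times [kappa - Q],
    and [kappa] takes the value [Q] at [1]; so it is enough that [kappa] is
    increasing. *)
Section Pointwise.
Variables (R : rcfType) (d e q : nat).
Hypothesis dE : d = e.+1.
Hypothesis hq : (d < q)%N.
Let Q : R := q%:R.
Let g (a : R) : R := (Q - a ^+ d) / (Q - 1).

Let Q1 : 0 < Q - 1.
Proof. by rewrite subr_gt0 /Q ltr1n; apply: leq_trans hq; rewrite dE. Qed.
Let dQ : d%:R <= Q - 1.
Proof. by rewrite lerBrDr natr1 ler_nat. Qed.
Let d0 : 0 < d%:R :> R.
Proof. by rewrite ltr0n dE. Qed.

Let kappa : {poly R} :=
  (Q - 1)%:P * 'X + ((Q%:P - 'X^d) * ((Q - 1)^-1)%:P) ^+ d.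

Let kappaE a : kappa.[a] = (Q - 1) * a + g a ^+ d.
Proof. by rewrite /kappa !hornerE /g. Qed.

Let g_ge0 a : a ^+ d <= Q -> 0 <= g a.
Proof. by move=> h; rewrite divr_ge0 ?subr_ge0 // -subr_ge0 ltW. Qed.

(** This says that [kappa] has a nonnegative derivative.  It is where [d < q] is
    needed: [g c ^+ d * c ^+ d] is at most [(Q - 1) / d] by
    [expr_mul_tangent_le1]. *)
Let step_le c : 0 <= c -> c ^+ d <= Q ->
  d%:R ^+ 2 * (g c * c) ^+ e <= (Q - 1) ^+ 2.
Proof.
move=> c0 cQ; have G0 := g_ge0 cQ.
have H0 : (g c * c) ^+ d <= (Q - 1) / d%:R.
  have cE : c ^+ d = Q - (Q - 1) * g c.
    by rewrite /g mulrCA divff ?gt_eqF // mulr1; ring.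
  have : (Q - 1) * (g c ^+ d * (1 + d%:R * (1 - g c))) <= (Q - 1) * 1.
    by apply: ler_wpM2l; [exact: ltW|exact: expr_mul_tangent_le1].
  rewrite mulr1 [(g c * c) ^+ d]exprMn ler_pdivlMr //; apply: le_trans.
  rewrite mulrCA -mulrA ler_wpM2l ?exprn_ge0 // cE -subr_ge0.
  have -> : (Q - 1) * (1 + d%:R * (1 - g c)) - (Q - (Q - 1) * g c) * d%:R
    = Q - 1 - d%:R by ring.
  by rewrite subr_ge0.
have H1 : 1 <= (Q - 1) / d%:R by rewrite ler_pdivlMr // mul1r.
have H2 : (g c * c) ^+ e <= ((Q - 1) / d%:R) ^+ 2.
  have gc0 : 0 <= g c * c by rewrite mulr_ge0.
  have [le1|gt1] := leP (g c * c) 1.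
    apply: (@le_trans _ _ 1); first by rewrite exprn_ile1.
    by rewrite exprn_ege1.
  apply: (@le_trans _ _ ((g c * c) ^+ d)).
    by rewrite dE exprS ler_peMl ?exprn_ge0 // ltW.
  by apply: le_trans H0 _; rewrite expr2 ler_peMl // (le_trans ler01).
by rewrite mulrC -ler_pdivlMr ?exprn_gt0 // -expr_div_n.
Qed.

Let kappa_incr x y : 0 <= x -> x <= y -> y ^+ d <= Q ->
  kappa.[x] <= kappa.[y].
Proof.
move=> x0 xy yQ.
apply: (@ler_hornerW _ x y) => //; rewrite ?in_itv /= ?lexx ?xy //.
move=> c; rewrite in_itv /= => /andP[xc cy].
have c0 : 0 <= c by rewrite (le_trans x0) ?ltW.
have cQ : c ^+ d <= Q.
  by apply: le_trans yQ; rewrite lerXn2r ?nnegrE ?(le_trans x0) // ltW.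
have := step_le c0 cQ.
rewrite exprMn => h.
rewrite /kappa !derivCE (_ : d.-1 = e) ?dE // -dE !(hornerE, hornerMn) /= -/(g c).
rewrite [X in 0 <= X](_ : _ =
    ((Q - 1) ^+ 2 - d%:R ^+ 2 * (g c ^+ e * c ^+ e)) / (Q - 1)); last first.
  by field; rewrite gt_eqF.
by rewrite divr_ge0 ?(ltW Q1) // subr_ge0.
Qed.

Let psi : {poly R} :=
  (d%:R : R)%:P * ('X^(d.+1) - 1) + 1 - (d.+1%:R * Q / (Q - 1))%:P * ('X^d - 1)
  - ((Q%:P - 'X^d) * ((Q - 1)^-1)%:P) ^+ d.+1.

Let psiE a : psi.[a] = 1 + d%:R * (a ^+ d.+1 - 1)
   - (d.+1%:R * Q / (Q - 1)) * (a ^+ d - 1) - g a ^+ d.+1.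
Proof. by rewrite /psi !hornerE /= -/(g a) /g; ring. Qed.

Let dpsiE a : (deriv psi).[a] =
  d.+1%:R * d%:R * a ^+ e / (Q - 1) * (kappa.[a] - Q).
Proof.
rewrite kappaE /psi !derivCE !(hornerE, hornerMn) /= -/(g a).
rewrite (_ : d.-1 = e) ?dE // -dE (_ : a ^+ d = a * a ^+ e) ?dE ?exprS //.
by rewrite -dE -!natr1; field; rewrite gt_eqF.
Qed.

Let kappa1 : kappa.[1] = Q.
Proof. by rewrite kappaE /g expr1n divff ?gt_eqF // expr1n; ring. Qed.

Let psi1 : psi.[1] = 0.
Proof. by rewrite psiE /g !expr1n divff ?gt_eqF // expr1n; ring. Qed.

(** Both sides agree to first order at [a = 1], and their difference is a convex
    function of [a ^+ d] on the interval from [0] to [Q].  The affine term in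
    [a ^+ d] makes this possible and disappears when the inequality is summed over
    a vector with a prescribed sum of [d]-th powers. *)
Lemma compl_pow_le (a : R) : 0 <= a -> a ^+ d <= Q ->
  ((Q - a ^+ d) / (Q - 1)) ^+ d.+1 <=
    1 + d%:R * (a ^+ d.+1 - 1) - (d.+1%:R * Q / (Q - 1)) * (a ^+ d - 1).
Proof.
move=> a0 aQ; rewrite -subr_ge0 -/(g a) -psiE -psi1.
have Q0 : 1 <= Q by rewrite -subr_ge0 ltW.
have cst c : 0 <= c -> 0 <= d.+1%:R * d%:R * c ^+ e / (Q - 1).
  by move=> c0; rewrite divr_ge0 ?mulr_ge0 ?exprn_ge0 // ltW.
have [a1|/ltW a1] := leP 1 a.
  apply: (@ler_hornerW _ 1 a) => //; rewrite ?in_itv /= ?lexx ?a1 //.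
  move=> c; rewrite in_itv /= => /andP[c1 ca]; rewrite dpsiE.
  have c0 : 0 <= c by rewrite (le_trans ler01) ?ltW.
  rewrite mulr_ge0 ?cst // subr_ge0 -kappa1; apply: kappa_incr => //.
    exact: ltW.
  by apply: le_trans aQ; rewrite lerXn2r ?nnegrE // ltW.
rewrite -lerN2 -!hornerN.
apply: (@ler_hornerW _ a 1) => //; rewrite ?in_itv /= ?lexx ?a1 //.
move=> c; rewrite in_itv /= => /andP[ac c1]; rewrite derivN hornerN dpsiE.
have c0 : 0 <= c by rewrite (le_trans a0) ?ltW.
rewrite -mulrN mulr_ge0 ?cst // oppr_ge0 subr_le0 -kappa1.
by apply: kappa_incr; rewrite ?expr1n // ltW.
Qed.

End Pointwise.

Lemma bernoulli_ge0 (R : realFieldType) (d : nat) (x : R) :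
  0 <= x -> 1 + d%:R * (x - 1) <= x ^+ d.
Proof.
move=> x0; elim: d => [|d IH]; first by rewrite mul0r addr0.
rewrite exprS; apply: le_trans (ler_wpM2l x0 IH); rewrite -subr_ge0.
have -> : x * (1 + d%:R * (x - 1)) - (1 + d.+1%:R * (x - 1))
  = d%:R * (x - 1) ^+ 2 by rewrite -natr1; ring.
by rewrite mulr_ge0 // sqr_ge0.
Qed.

Lemma young_pow (R : realFieldType) (d : nat) (x y : R) : 0 <= x -> 0 <= y ->
  d.+1%:R * (x * y ^+ d) <= x ^+ d.+1 + d%:R * y ^+ d.+1.
Proof.
move=> x0; rewrite le_eqVlt => /orP[/eqP <-|y0].
  case: d => [|d]; first by rewrite !expr0 expr1 mul0r addr0 mul1r mulr1.
  by rewrite !expr0n /= !mulr0 addr0 exprn_ge0.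
have := bernoulli_ge0 d.+1 (divr_ge0 x0 (ltW y0)).
rewrite expr_div_n ler_pdivlMr ?exprn_gt0 // => h; rewrite -lerBlDr.
apply: le_trans h; rewrite le_eqVlt; apply/orP; left; apply/eqP.
by rewrite exprS -natr1; field; rewrite gt_eqF.
Qed.

Lemma exists_root (R : realType) (d : nat) (x : R) : (0 < d)%N -> 0 <= x ->
  exists2 y : R, 0 <= y & y ^+ d = x.
Proof.
move=> d0 x0; exists (x `^ d%:R^-1); first exact: powR_ge0.
by rewrite -powR_mulrn ?powR_ge0 // -powRrM mulVf ?powRr1 // pnatr_eq0 -lt0n.
Qed.

Section Bilinear.
Variables (R : realType) (C : finType) (d : nat).
Hypothesis hC : (d < #|C|)%N.
Let Q : R := #|C|%:R.

Let Q0 : 0 < Q. Proof. by rewrite /Q ltr0n (leq_ltn_trans _ hC). Qed.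

(** The normalisation of [a] kills the linear term of [compl_pow_le]; Bernoulli's
    inequality then makes the bound homogeneous. *)
Lemma sum_compl_pow_le (a : C -> R) : (0 < d)%N ->
  (forall c, 0 <= a c) -> \sum_c a c ^+ d = Q ->
  \sum_c ((Q - a c ^+ d) / (Q - 1)) ^+ d.+1
    <= Q * ((\sum_c a c ^+ d.+1) / Q) ^+ d.
Proof.
move: hC; case: d => // e he _ a0 aS.
have Q1 : 0 < Q - 1 by rewrite subr_gt0 /Q ltr1n (leq_trans _ he).
have aQ c : a c ^+ e.+1 <= Q.
  by rewrite -aS (bigD1 c) //= lerDl sumr_ge0 // => i _; rewrite exprn_ge0.
apply: (@le_trans _ _ (\sum_c (1 + e.+1%:R * (a c ^+ e.+2 - 1)
   - (e.+2%:R * Q / (Q - 1)) * (a c ^+ e.+1 - 1)))).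
  by apply: ler_sum => c _; apply: (compl_pow_le erefl he).
have sum1 : \sum_(c : C) (1 : R) = Q by rewrite sumr_const.
rewrite !big_split /= sumrN -!mulr_sumr !sumrB sum1 aS subrr mulr0 subr0.
set X := \sum_c _.
have X0 : 0 <= X by apply: sumr_ge0 => c _; rewrite exprn_ge0.
have h := bernoulli_ge0 e.+1 (divr_ge0 X0 (ltW Q0)).
apply: le_trans (ler_wpM2l (ltW Q0) h).
by rewrite le_eqVlt; apply/orP; left; apply/eqP; field; rewrite gt_eqF.
Qed.

(** With [f = a ^+ d] and [h = b ^+ d] this bounds a bilinear form in [f] and [h]
    by their [l^(r/d)] norms, for [r = d.+1]: the norm of the adjacency operator
    of the complete graph on [C], from [l^(r/d)] to its dual [l^r], is attained
    at constant vectors.  By Young's inequality it is enough to bound the [l^r]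
    norm of the image of [f], which is [sum_compl_pow_le]. *)
Lemma bilinear_neq_le (a b : C -> R) (A B : R) :
  (forall c, 0 <= a c) -> (forall c, 0 <= b c) -> 0 <= A -> 0 <= B ->
  Q * A ^+ d.+1 = \sum_c a c ^+ d.+1 -> Q * B ^+ d.+1 = \sum_c b c ^+ d.+1 ->
  \sum_c \sum_(c' | c' != c) a c ^+ d * b c' ^+ d
    <= Q * (Q - 1) * (A ^+ d * B ^+ d).
Proof.
move=> a0 b0 A0 B0 HA HB.
have Q1 : 0 <= Q - 1 by rewrite subr_ge0 /Q ler1n (leq_ltn_trans _ hC).
have cE (c : C) : \sum_(c' | c' != c) (1 : R) = Q - 1.
  have : \sum_(c' : C) (1 : R) = Q by rewrite sumr_const.
  by rewrite (bigD1 c) //= => <-; rewrite [1 + _]addrC addrK.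
have RHS0 : 0 <= Q * (Q - 1) * (A ^+ d * B ^+ d).
  by rewrite !mulr_ge0 ?exprn_ge0 // ltW.
have [d0|d0] := posnP d.
  rewrite le_eqVlt; apply/orP; left; apply/eqP; rewrite d0 !expr0 !mulr1.
  rewrite (eq_bigr (fun=> Q - 1)) => [|c _]; last first.
    by rewrite -(cE c).
  by rewrite sumr_const -mulr_natl.
set S := \sum_c a c ^+ d.
have S0 : 0 <= S by apply: sumr_ge0 => c _; rewrite exprn_ge0.
have lhsE : \sum_c \sum_(c' | c' != c) a c ^+ d * b c' ^+ d
   = \sum_c (S - a c ^+ d) * b c ^+ d.
  rewrite (exchange_big_dep xpredT) //=; apply: eq_bigr => c _.
  rewrite -mulr_suml /S [in RHS](bigD1 c) //= [a c ^+ d + _]addrC addrK.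
  by congr (_ * _); apply: eq_bigl => i; rewrite eq_sym.
have pow0 (x : C -> R) k : (forall c, 0 <= x c) -> \sum_c x c ^+ k.+1 = 0 ->
    forall c, x c = 0.
  move=> x0 /psumr_eq0P h c; apply/eqP.
  by move: (h (fun i _ => exprn_ge0 _ (x0 i)) c isT) => /eqP; rewrite expf_eq0 => /andP[].
have zeroL (x : C -> R) X : (forall c, 0 <= x c) -> Q * X ^+ d.+1 = \sum_c x c ^+ d.+1 ->
    X = 0 -> forall c, x c ^+ d = 0.
  move=> x0 + X0 c; rewrite X0 exprS mul0r mulr0 => /esym h.
  by rewrite (pow0 _ _ x0 h) expr0n gtn_eqF.
have [AE|An0] := eqVneq A 0.
  apply: le_trans RHS0; rewrite big1 // => c _; rewrite big1 // => c' _.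
  by rewrite (zeroL _ _ a0 HA AE) mul0r.
have [BE|Bn0] := eqVneq B 0.
  apply: le_trans RHS0; rewrite big1 // => c _; rewrite big1 // => c' _.
  by rewrite (zeroL _ _ b0 HB BE) mulr0.
have Agt : 0 < A by rewrite lt_neqAle eq_sym An0.
have Bgt : 0 < B by rewrite lt_neqAle eq_sym Bn0.
have Sgt : 0 < S.
  rewrite lt_neqAle S0 andbT eq_sym; apply/eqP => SE.
  have [k dE] : exists k, d = k.+1 by exists d.-1; rewrite prednK.
  move: (pow0 a k a0); rewrite -dE => /(_ SE) az.
  move: HA; rewrite big1 => [/eqP|c _]; last by rewrite az exprS mul0r.
  by rewrite mulf_eq0 gt_eqF //= expf_eq0 (negPf An0) andbF.
have Q1gt : 0 < Q - 1 by rewrite subr_gt0 /Q ltr1n (leq_ltn_trans d0 hC).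
(* [a / th] has the normalisation required by [sum_compl_pow_le]. *)
have [th th0 thE] := exists_root d0 (divr_ge0 S0 (ltW Q0)).
have thgt : 0 < th.
  rewrite lt_neqAle th0 andbT eq_sym; apply/eqP => thz.
  by move: thE => /eqP; rewrite thz expr0n gtn_eqF // eq_sym gt_eqF // divr_gt0.
have SE : S = Q * th ^+ d by rewrite thE mulrC divfK ?gt_eqF.
(* The image of [a ^+ d] under the adjacency operator, scaled to be at most 1
   in mean [d.+1]-st power. *)
pose v c := (S - a c ^+ d) / ((Q - 1) * A ^+ d).
have v0 c : 0 <= v c.
  rewrite divr_ge0 ?mulr_ge0 ?exprn_ge0 // subr_ge0 /S (bigD1 c) //= lerDl.
  by apply: sumr_ge0 => i _; rewrite exprn_ge0.
have vS : \sum_c v c ^+ d.+1 <= Q.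
  have := @sum_compl_pow_le (fun c => a c / th) d0.
  have -> : \sum_c (a c / th) ^+ d = Q.
    under eq_bigr do rewrite expr_div_n.
    by rewrite -mulr_suml -/S SE mulfK // gt_eqF ?exprn_gt0.
  have -> : \sum_c (a c / th) ^+ d.+1 = Q * (A / th) ^+ d.+1.
    under eq_bigr do rewrite expr_div_n.
    by rewrite -mulr_suml -HA expr_div_n mulrA.
  rewrite [_ / Q]mulrAC divff ?gt_eqF // mul1r.
  move=> /(_ (fun c => divr_ge0 (a0 c) th0) erefl).
  rewrite exprAC -ler_pdivrMr ?exprn_gt0 ?divr_gt0 //; apply: le_trans.
  rewrite mulr_suml le_eqVlt; apply/orP; left; apply/eqP/eq_bigr => c _.
  rewrite -exprVn -exprMn; congr (_ ^+ _).
  rewrite /v SE !expr_div_n; field.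
  by rewrite !gt_eqF ?exprn_gt0.
have main : \sum_c v c * (b c / B) ^+ d <= Q.
  have yg c : d.+1%:R * (v c * (b c / B) ^+ d) <= v c ^+ d.+1 + d%:R * (b c / B) ^+ d.+1.
    by rewrite young_pow // divr_ge0.
  have : d.+1%:R * \sum_c v c * (b c / B) ^+ d <= d.+1%:R * Q.
    rewrite mulr_sumr; apply: (le_trans (ler_sum _ (fun c _ => yg c))).
    rewrite big_split /= -mulr_sumr.
    have -> : \sum_c (b c / B) ^+ d.+1 = Q.
      under eq_bigr do rewrite expr_div_n.
      by rewrite -mulr_suml -HB mulfK // gt_eqF // exprn_gt0.
    by rewrite -natr1 mulrDl mul1r addrC lerD2l.
  by rewrite ler_pM2l // ltr0n.
rewrite lhsE.
have -> : \sum_c (S - a c ^+ d) * b c ^+ d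
   = (Q - 1) * (A ^+ d * B ^+ d) * \sum_c v c * (b c / B) ^+ d.
  rewrite mulr_sumr; apply: eq_bigr => c _; rewrite /v expr_div_n; field.
  by rewrite !gt_eqF ?exprn_gt0.
rewrite -[leRHS]mulrA [leRHS]mulrC; apply: ler_wpM2l main.
by rewrite !mulr_ge0 ?exprn_ge0.
Qed.

(** The bound of [bilinear_neq_le] tensorises: apply it to the first coordinates
    for fixed second coordinates, and then to the vector of the norms [A y] of
    the fibres. *)
Lemma bilinear_neq2_le (F : C * C -> R) (rho : R) :
  (forall u, 0 <= F u) -> 0 <= rho ->
  Q ^+ 2 * rho ^+ d.+1 = \sum_u F u ^+ d.+1 ->
  \sum_u \sum_(v | (u.1 != v.1) && (u.2 != v.2)) F u ^+ d * F v ^+ d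
    <= (Q * (Q - 1)) ^+ 2 * (rho ^+ d) ^+ 2.
Proof.
move=> F0 rho0 HF.
have Q1 : 0 <= Q - 1 by rewrite subr_ge0 /Q ler1n (leq_ltn_trans _ hC).
have ex y : exists A, 0 <= A /\ A ^+ d.+1 = (\sum_x F (x, y) ^+ d.+1) / Q.
  have [|A A0 AE] := @exists_root R d.+1 ((\sum_x F (x, y) ^+ d.+1) / Q) (ltn0Sn d).
    by rewrite divr_ge0 ?(ltW Q0) // sumr_ge0 // => i _; rewrite exprn_ge0.
  by exists A.
have [A HA] := choice ex.
have A0 y : 0 <= A y by case: (HA y).
have AE y : Q * A y ^+ d.+1 = \sum_x F (x, y) ^+ d.+1.
  by case: (HA y) => _ ->; rewrite mulrC divfK // gt_eqF.
have AS : Q * rho ^+ d.+1 = \sum_y A y ^+ d.+1.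
  apply: (mulfI (lt0r_neq0 Q0)); rewrite mulrA -expr2 HF mulr_sumr.
  under [RHS]eq_bigr do rewrite AE.
  rewrite exchange_big /= pair_big /=.
  by apply: eq_bigr => -[x y].
have outer := bilinear_neq_le A0 A0 rho0 rho0 AS AS.
rewrite (_ : \sum_u _ = \sum_y \sum_(y' | y' != y)
   \sum_x \sum_(x' | x' != x) F (x, y) ^+ d * F (x', y') ^+ d); last first.
  transitivity (\sum_x \sum_y \sum_(v : C * C | (x != v.1) && (y != v.2))
      F (x, y) ^+ d * F v ^+ d).
    by rewrite pair_bigA; apply: eq_bigr => -[x y].
  rewrite exchange_big /=; apply: eq_bigr => y _.
  rewrite [RHS]exchange_big /=; apply: eq_bigr => x _.
  rewrite (eq_bigr (fun v => F (x, y) ^+ d * F (v.1, v.2) ^+ d)); last by case.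
  rewrite -(pair_big (fun x' => x != x') (fun y' => y != y')
     (fun x' y' => F (x, y) ^+ d * F (x', y') ^+ d)) /=.
  rewrite exchange_big /=.
  by apply: eq_big => [i|i _]; [|apply: eq_bigl => j]; rewrite eq_sym.
apply: (@le_trans _ _ (\sum_y \sum_(y' | y' != y)
   Q * (Q - 1) * (A y ^+ d * A y' ^+ d))).
  apply: ler_sum => y _; apply: ler_sum => y' _.
  by apply: bilinear_neq_le => // ; move=> c; apply: F0.
under eq_bigr do rewrite -mulr_sumr; rewrite -mulr_sumr.
rewrite [(_ * _) ^+ 2]expr2 -[leRHS]mulrA [(rho ^+ d) ^+ 2]expr2.
by apply: ler_wpM2l outer; rewrite mulr_ge0 // ltW.
Qed.

End Bilinear.

(** * Words and their letter counts *)

Section Words.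
Variables (P I : finType).

Definition content (t : {ffun P -> I}) : {ffun I -> nat} :=
  [ffun i => #|[set p | t p == i]%SET|].

Definition words (k : {ffun I -> nat}) : {set {ffun P -> I}} :=
  [set t | content t == k]%SET.

Lemma in_words k t : (t \in words k) = (content t == k).
Proof. by rewrite inE. Qed.

Definition set_letter (t : {ffun P -> I}) p i : {ffun P -> I} :=
  [ffun p' => if p' == p then i else t p'].

Lemma contentE t i : content t i = (\sum_p (t p == i))%N.
Proof. by rewrite ffunE -sum1dep_card big_mkcond /=; apply: eq_bigr => p _; case: eqP. Qed.

Lemma sum_content t : (\sum_i content t i)%N = #|P|.
Proof.
under eq_bigr do rewrite contentE.
rewrite exchange_big /= -sum1_card; apply: eq_bigr => p _.
by rewrite (bigD1 (t p)) //= eqxx big1 ?addn0 // => i; rewrite eq_sym => /negPf ->.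
Qed.

Lemma content_set_letter t p i c :
  (content (set_letter t p i) c + (t p == c) = content t c + (i == c))%N.
Proof.
rewrite !contentE (bigD1 p) //= [in RHS](bigD1 p) //= ffunE eqxx.
rewrite (eq_bigr (fun p' => (t p' == c : nat))); last first.
  by move=> p' /negPf h; rewrite ffunE h.
by rewrite addnC addnAC addnA.
Qed.

Lemma prod_content (R : comPzSemiRingType) (x : I -> R) (t : {ffun P -> I}) :
  \prod_p x (t p) = \prod_i x i ^+ content t i.
Proof.
rewrite (partition_big t xpredT) //=; apply: eq_bigr => i _.
rewrite (eq_bigr (fun=> x i)) => [|p /eqP -> //].
by rewrite prodr_const ffunE; congr (_ ^+ _); apply: eq_card => p; rewrite inE.
Qed.

Lemma sum_words_prod (R : comPzSemiRingType) (x : I -> R) :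
  \sum_(t : {ffun P -> I}) \prod_p x (t p) = (\sum_i x i) ^+ #|P|.
Proof.
by rewrite -(bigA_distr_bigA (fun (_ : P) i => x i)) /= prodr_const.
Qed.

Lemma card_words_weight (R : numDomainType) (x : I -> R) k :
  (forall i, 0 <= x i) ->
  #|words k|%:R * \prod_i x i ^+ k i <= (\sum_i x i) ^+ #|P|.
Proof.
move=> x0; rewrite -sum_words_prod (bigID (fun t => t \in words k)) /=.
have -> : \sum_(t in words k) \prod_p x (t p)
    = \sum_(t in words k) \prod_i x i ^+ k i.
  by apply: eq_bigr => t; rewrite in_words prod_content => /eqP ->.
rewrite sumr_const mulr_natl lerDl sumr_ge0 // => t _.
by rewrite prodr_ge0.
Qed.

(** Pairs of a word and a position carrying [j] inject into pairs of a word and a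
    position carrying [i]: rewrite the letter at that position. *)
Lemma card_words_move (l l' : {ffun I -> nat}) (i j : I) : i != j ->
  (forall c, l' c + (j == c) = l c + (i == c))%N ->
  (#|words l| * l j <= #|words l'| * l' i)%N.
Proof.
move=> ij h.
pose S (k : {ffun I -> nat}) (c : I) : {set {ffun P -> I} * P} :=
  [set u | (u.1 \in words k) && (u.1 u.2 == c)]%SET.
have cS k c : #|S k c| = (#|words k| * k c)%N.
  rewrite -sum1dep_card -(pair_big_dep (fun t => t \in words k) (fun t p => t p == c) (fun _ _ => 1%N)) /=.
  rewrite -sum_nat_const; apply: eq_bigr => t; rewrite in_words => /eqP <-.
  by rewrite sum1dep_card ffunE.
rewrite -!cS.
pose f (u : {ffun P -> I} * P) := (set_letter u.1 u.2 i, u.2).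
have finj : {in S l j &, injective f}.
  move=> [t p] [t' p']; rewrite !inE /= => /andP[_ /eqP tp] /andP[_ /eqP tp'] [].
  move=> /ffunP e ep; rewrite -ep in tp' e *; congr (_, _); apply/ffunP => x.
  have := e x; rewrite !ffunE; case: eqP => // -> _; by rewrite tp tp'.
rewrite -(card_in_imset finj); apply: subset_leq_card.
apply/fintype.subsetP => _ /imsetP[[t p] + ->]; rewrite !inE /= => /andP[/eqP tl /eqP tp].
rewrite ffunE eqxx eqxx andbT; apply/eqP/ffunP => c.
by have := content_set_letter t p i c; rewrite tp tl -h => /eqP; rewrite eqn_add2r => /eqP.
Qed.

(** The multinomial distribution with weights proportional to [k] has its mode at
    [k]: as long as [l] differs from [k], moving one letter from an
    over-represented [j] to an under-represented [i] does not decrease the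
    weight. *)
Lemma words_mode (R : realFieldType) (k l : {ffun I -> nat}) :
  (\sum_i l i = \sum_i k i)%N ->
  #|words l|%:R * \prod_i (k i)%:R ^+ l i <=
  #|words k|%:R * \prod_i (k i)%:R ^+ k i :> R.
Proof.
move: {2}(\sum_i (l i - k i))%N (erefl (\sum_i (l i - k i))%N) => n.
elim: n l => [|n IH] l ln lk.
  have lek i : (l i <= k i)%N.
    by rewrite -subn_eq0; move: ln => /eqP; rewrite sum_nat_eq0 => /forallP/(_ i).
  have -> // : l = k.
  apply/ffunP => i; apply/eqP; rewrite eqn_leq lek /=.
  move: lk; rewrite (bigD1 i) //= [in RHS](bigD1 i) //=.
  have := @leq_sum _ (index_enum I) (fun j => j != i) l k (fun j _ => lek j).
  lia.
have [j jP] : exists j, (k j < l j)%N.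
  apply/existsP; apply: contra_eqT ln => /existsPn h.
  rewrite big1 // => i _; apply/eqP; rewrite subn_eq0 leqNgt; exact: h.
have [i iP] : exists i, (l i < k i)%N.
  apply/existsP; apply: contra_eqT lk => /existsPn h.
  have := @leq_sum _ (index_enum I) (fun c => c != j) k l (fun c _ => _).
  rewrite [X in X != _](bigD1 j) //= [X in _ != X](bigD1 j) //= => H.
  have : (\sum_(c | c != j) k c <= \sum_(c | c != j) l c)%N.
    by apply: H => c; rewrite leqNgt; apply: h.
  by apply: contraTneq; lia.
have ij : i != j by apply: contraTneq iP => ->; rewrite -leqNgt ltnW.
(* One step from [l] towards [k]. *)
pose l' : {ffun I -> nat} := [ffun c => (l c + (i == c) - (j == c))%N].
have l'E c : (l' c + (j == c) = l c + (i == c))%N.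
  by rewrite ffunE subnK //; case: (j =P c) => [<-|//]; rewrite (leq_trans _ (leq_addr _ _)) // (leq_trans _ jP).
clearbody l'.
have l'i : l' i = (l i).+1 by have := l'E i; rewrite eqxx [j == i]eq_sym (negPf ij); lia.
have l'j : l j = (l' j).+1 by have := l'E j; rewrite eqxx (negPf ij); lia.
have l'c c : c != i -> c != j -> l' c = l c.
  by move=> ci cj; have := l'E c; rewrite [i == c]eq_sym [j == c]eq_sym (negPf ci) (negPf cj); lia.
have ji : j != i by rewrite eq_sym.
apply: (@le_trans _ _ (#|words l'|%:R * \prod_c (k c)%:R ^+ l' c)); last first.
  apply: IH.
    move: ln; rewrite (bigD1 j) //= (bigD1 i) //= => ln.
    rewrite (bigD1 j) //= (bigD1 i) //= (eq_bigr (fun c => (l c - k c)%N)); last first.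
      by move=> c /andP[cj ci]; rewrite l'c.
    move: ln; move: (\sum_(_ | _) _)%N l'i l'j iP jP; clear; lia.
  move: lk; rewrite (bigD1 j) //= (bigD1 i) //= => <-.
  rewrite (bigD1 j) //= (bigD1 i) //= (eq_bigr l); last first.
    by move=> c /andP[cj ci]; rewrite l'c.
  by move: (\sum_(_ | _) _)%N l'i l'j; clear; lia.
have mv := card_words_move ij l'E.
rewrite !(bigD1 j (P := xpredT)) //= !(bigD1 i (P := fun c => c != j)) //=.
rewrite [in leRHS](eq_bigr (fun c => (k c)%:R ^+ l c)); last first.
  by move=> c /andP[cj ci]; rewrite l'c.
set rest := \prod_(c | _) _.
have rest0 : 0 <= rest by apply: prodr_ge0 => c _; rewrite exprn_ge0.
rewrite l'i l'j !exprS.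
have [k0|k0] := posnP (k j).
  by rewrite k0 !mul0r mulr0; do ![apply: mulr_ge0 => //]; apply: exprn_ge0.
set u := _ ^+ l' j; set v := _ ^+ l i.
have u0 : 0 <= u * (v * rest) by rewrite !mulr_ge0 ?exprn_ge0.
rewrite (_ : _ * _ = (#|words l|%:R * (k j)%:R) * (u * (v * rest))); last ring.
rewrite [leRHS](_ : _ = (#|words l'|%:R * (k i)%:R) * (u * (v * rest))); last ring.
apply: ler_wpM2r => //; rewrite -!natrM ler_nat.
rewrite -(@leq_pmul2r (l' i)); last by rewrite l'i.
apply: (@leq_trans (#|words l| * l j * k i)).
  rewrite -!mulnA leq_mul2l; apply/orP; right; apply: leq_mul; first exact: ltnW.
  by rewrite l'i.
by rewrite [leqRHS]mulnAC leq_mul2r mv orbT.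
Qed.

(** The most likely of the at most [(N + 1) ^ #|I|] contents has at least the
    average probability. *)
Lemma card_words_ge (R : realFieldType) (k : {ffun I -> nat}) :
  (\sum_i k i)%N = #|P| ->
  #|P|%:R ^+ #|P| <=
   #|P|.+1%:R ^+ #|I| * (#|words k|%:R * \prod_i (k i)%:R ^+ k i) :> R.
Proof.
move=> kP.
pose toK (t : {ffun P -> I}) : {ffun I -> 'I_#|P|.+1} := [ffun i => inord (content t i)].
have toKE t i : toK t i = content t i :> nat.
  by rewrite ffunE inordK // ltnS -(sum_content t) (bigD1 i) //= leq_addr.
have := @sum_words_prod R (fun i => (k i)%:R).
rewrite -natr_sum kP => <-.
rewrite (partition_big toK xpredT) //=.
apply: (@le_trans _ _ (\sum_(K : {ffun I -> 'I_#|P|.+1})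
   (#|words k|%:R * \prod_i (k i)%:R ^+ k i))); last first.
  rewrite sumr_const card_ffun card_ord -natrX. by rewrite [leRHS]mulr_natl lexx.
apply: ler_sum => K _.
pose l : {ffun I -> nat} := [ffun i => K i : nat].
have tl t : toK t == K -> content t = l.
  by move=> /eqP tK; apply/ffunP => i; rewrite [RHS]ffunE -tK toKE.
have [t0 t0K|none] := pickP (fun t => toK t == K); last first.
  rewrite big_pred0 // mulr_ge0 // prodr_ge0 // => i _; exact: exprn_ge0.
have lP : (\sum_i l i = \sum_i k i)%N by rewrite -(tl _ t0K) sum_content kP.
apply: le_trans (words_mode R lP).
have -> : \sum_(t | toK t == K) \prod_p (k (t p))%:R
    = \sum_(t | toK t == K) \prod_i (k i)%:R ^+ l i :> R.
  by apply: eq_bigr => t /tl tE; rewrite (prod_content (fun i => (k i)%:R)) tE.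
rewrite sumr_const -(mulr_natl (\prod_(i : I) _)); apply: ler_wpM2r.
  by rewrite prodr_ge0 // => i _; exact: exprn_ge0.
rewrite ler_nat; apply: subset_leq_card; apply/fintype.subsetP => t.
by rewrite in_words => /tl ->.
Qed.

(** Almost uniform contents have almost maximal entropy: deviations of bounded
    size only cost the constant factor [expR C]. *)
Lemma card_words_balanced_ge (R : realType) (k : {ffun I -> nat}) (s C : nat) :
  (\sum_i k i)%N = #|P| -> (forall i, (s * k i <= #|P| + C)%N) ->
  s%:R ^+ #|P| <= #|P|.+1%:R ^+ #|I| * #|words k|%:R * expR C%:R :> R.
Proof.
move=> kP hk.
have h1 : s%:R ^+ #|P| * (\prod_i (k i)%:R ^+ k i) <= (#|P| + C)%:R ^+ #|P| :> R.
  rewrite -kP -!prodrXr -big_split /= ler_prod // => i _.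
  by rewrite -exprMn exprn_ge0 //= lerXn2r ?nnegrE // -natrM ler_nat kP.
have h2 : (#|P| + C)%:R ^+ #|P| <= #|P|%:R ^+ #|P| * expR C%:R :> R.
  have [->|P0] := posnP #|P|; first by rewrite !expr0 mul1r -expR0 ler_expR.
  have P0' : 0 < #|P|%:R :> R by rewrite ltr0n.
  rewrite -ler_pdivrMl ?exprn_gt0 // -exprVn -exprMn natrD mulrDr mulVf ?gt_eqF //.
  have -> : expR C%:R = expR (#|P|%:R^-1 * C%:R) ^+ #|P| :> R.
    by rewrite -expRM_natl mulrA divff ?gt_eqF // mul1r.
  by rewrite lerXn2r ?nnegrE ?expR_ge0 ?expR_ge1Dx // addr_ge0 // mulr_ge0 // invr_ge0.
have NN : 0 < #|P|%:R ^+ #|P| :> R.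
  by have [->|P0] := posnP #|P|; rewrite ?expr0 // exprn_gt0 // ltr0n.
rewrite -(ler_pM2l NN).
apply: le_trans (ler_wpM2r (exprn_ge0 _ (ler0n _ s)) (card_words_ge R kP)) _.
rewrite [leLHS](_ : _ = #|P|.+1%:R ^+ #|I| * #|words k|%:R
   * (s%:R ^+ #|P| * \prod_i (k i)%:R ^+ k i)); last ring.
rewrite [leRHS](_ : _ = #|P|.+1%:R ^+ #|I| * #|words k|%:R
   * (#|P|%:R ^+ #|P| * expR C%:R)); last ring.
by apply: ler_wpM2l (le_trans h1 h2); rewrite mulr_ge0 ?exprn_ge0.
Qed.
End Words.

(** * Uniform shuffles of a word *)

Section Shuffle.
Variables (P I : finType).
Implicit Types (c t : {ffun P -> I}) (s : {perm P}).

Definition shuffle c s : {ffun P -> I} := [ffun p => c (s p)].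

Lemma content_shuffle c s : content (shuffle c s) = content c.
Proof.
apply/ffunP => i; rewrite !contentE [RHS](reindex_inj (@perm_inj _ s)) /=.
by apply: eq_bigr => p _; rewrite ffunE.
Qed.

Lemma shuffleM c s s' : shuffle (shuffle c s) s' = shuffle c (s' * s).
Proof. by apply/ffunP => p; rewrite !ffunE permM. Qed.

Lemma content_shuffleP c t : content t = content c -> exists s, t = shuffle c s.
Proof.
move=> h.
have cnt (f : {ffun P -> I}) i : count_mem i (fgraph f) = content f i.
  rewrite -codom_ffun contentE /codom /image_mem count_map -sum1_count big_enum_cond.
  by rewrite big_mkcond /=; apply: eq_bigr => p _; case: eqP.
have /tuple_permP[u uE] : perm_eq (fgraph t) (fgraph c).
  by apply/allP => i _; rewrite /= !cnt h.
have inj : injective (fun p => enum_val (u (enum_rank p))).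
  by move=> x y /enum_val_inj /perm_inj /enum_rank_inj.
exists (perm inj); apply/ffunP => p; rewrite ffunE permE -tnth_fgraph.
rewrite -[in LHS](enum_rankK p) -tnth_fgraph.
by rewrite (tnth_nth (t p)) uE nth_mktuple.
Qed.

Lemma card_perms : #|{perm P}| = (#|P|)`!.
Proof.
rewrite -cardsT -(card_perm [set: P]%SET); apply: eq_card => s.
by rewrite !inE; apply/esym/fintype.subsetP => p _; rewrite inE.
Qed.

(** Any two arrangements of the same letters differ by a permutation of the
    positions, and composing with it matches the shuffles that produce them. *)
Lemma card_shuffle_eq c t : content t = content c ->
  (#|[set s | shuffle c s == t]%SET| * #|words P (content c)| = (#|P|)`!)%N.
Proof.
move=> tc.
have same t' : content t' = content c ->
    #|[set s | shuffle c s == t']%SET| = #|[set s | shuffle c s == t]%SET|.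
  move=> t'c; have [|u ->] := @content_shuffleP t t'; first by rewrite t'c.
  rewrite -[RHS](card_imset _ (mulgI u)); apply: eq_card => s.
  rewrite inE; apply/eqP/imsetP => [e|[s' + ->]].
    exists (u^-1 * s)%g; last by rewrite mulKVg.
    rewrite inE -shuffleM e shuffleM mulVg; apply/eqP/ffunP => p.
    by rewrite ffunE perm1.
  by rewrite inE -shuffleM => /eqP ->.
rewrite mulnC -sum_nat_const -card_perms -[RHS]sum1_card.
rewrite [RHS](partition_big (shuffle c) (fun t' => t' \in words P (content c))).
  apply: eq_bigr => t'; rewrite in_words => /eqP /same <-.
  by rewrite -sum1_card; apply: eq_bigl => s; rewrite inE.
by move=> s _; rewrite in_words content_shuffle.
Qed.

(** Summing [card_shuffle_eq]: a random shuffle is a uniform word of its content,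
    which reduces events of shuffles to counting words. *)
Lemma card_shuffle_in c (B : pred {ffun P -> I}) :
  (#|[set s | B (shuffle c s)]%SET| * #|words P (content c)|
    = (#|P|)`! * #|[set t in words P (content c) | B t]%SET|)%N.
Proof.
rewrite -[#|[set s | _]%SET|]sum1_card.
rewrite (partition_big (shuffle c) (fun t => t \in [set t in words P (content c) | B t]%SET)) /=; last first.
  by move=> s; rewrite !inE content_shuffle eqxx.
rewrite big_distrl /= mulnC -sum_nat_const; apply: eq_bigr => t.
rewrite !inE => /andP[/eqP tc Bt]; rewrite -(card_shuffle_eq tc); congr (_ * _)%N.
rewrite -sum1_card; apply: eq_bigl => s; rewrite !inE.
by case: eqP => [->|_]; rewrite ?andbT ?andbF // Bt.
Qed.
End Shuffle.

(** * The second moment of the number of colourings of a random pairing *)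

Notation half_edges m := ('I_m * bool)%type.

Section Pairs.
Variables (m : nat) (I : finType).

Definition all_pairs (A : rel I) (t : {ffun half_edges m -> I}) : bool :=
  [forall k, A (t (k, false)) (t (k, true))].

Definition of_pairs (u : {ffun 'I_m -> I * I}) : {ffun half_edges m -> I} :=
  [ffun p => if p.2 then (u p.1).2 else (u p.1).1].

Lemma of_pairs_bij : bijective of_pairs.
Proof.
exists (fun t : {ffun half_edges m -> I} => [ffun k => (t (k, false), t (k, true))]) => [u|t].
  by apply/ffunP => k; rewrite !ffunE /=; case: (u k).
by apply/ffunP => -[k []]; rewrite !ffunE /=.
Qed.

(** The generating function of the words with compatible pairs factorises over the
    pairs. *)
Lemma sum_all_pairs (R : comPzSemiRingType) (A : rel I) (x : I -> R) :
  \sum_(t | all_pairs A t) \prod_p x (t p)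
   = (\sum_u (if A u.1 u.2 then x u.1 * x u.2 else 0)) ^+ m.
Proof.
pose g (u : I * I) := if A u.1 u.2 then x u.1 * x u.2 else 0.
rewrite -[in RHS](card_ord m) -(sum_words_prod 'I_m g).
rewrite (reindex of_pairs) /=; last exact: onW_bij of_pairs_bij.
rewrite big_mkcond /=; apply: eq_bigr => u _; rewrite /all_pairs.
have -> : \prod_(p : half_edges m) x (of_pairs u p) = \prod_k (x (u k).1 * x (u k).2).
  transitivity (\prod_(k < m) \prod_(b : bool) x (of_pairs u (k, b))).
    by rewrite pair_bigA; apply: eq_bigr => -[].
  by apply: eq_bigr => k _; rewrite big_bool !ffunE mulrC.
case: forallP => [h|/forallP].
  by apply: eq_bigr => k _; have := h k; rewrite /g !ffunE /= => ->.
rewrite negb_forall => /existsP[k]; rewrite !ffunE /= => /negPf h.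
by rewrite (bigD1 k) //= /g h mul0r.
Qed.

Lemma card_pairs_weight (R : realFieldType) (A : rel I) (x : I -> R)
    (k : {ffun I -> nat}) : (forall i, 0 <= x i) ->
  #|[set t in words (half_edges m) k | all_pairs A t]%SET|%:R * \prod_i x i ^+ k i
    <= (\sum_u \sum_(v | A u v) x u * x v) ^+ m.
Proof.
move=> x0.
have -> : \sum_u \sum_(v | A u v) x u * x v
   = \sum_u (if A u.1 u.2 then x u.1 * x u.2 else 0).
  transitivity (\sum_u \sum_v (if A u v then x u * x v else 0)).
    by apply: eq_bigr => u _; rewrite big_mkcond.
  by rewrite pair_bigA; apply: eq_bigr => -[].
rewrite -sum_all_pairs (bigID (fun t => t \in words _ k)) /=.
have -> : \sum_(t | all_pairs A t && (t \in words _ k)) \prod_p x (t p)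
    = \sum_(t | all_pairs A t && (t \in words _ k)) \prod_i x i ^+ k i.
  by apply: eq_bigr => t /andP[_]; rewrite in_words prod_content => /eqP ->.
rewrite sumr_const mulr_natl.
rewrite (_ : #|[set t in _ | _]%SET| = #|[pred t | all_pairs A t && (t \in words (half_edges m) k)]|).
  by rewrite lerDl sumr_ge0 // => t _; rewrite prodr_ge0.
by apply: eq_card => t; rewrite !inE andbC.
Qed.
End Pairs.

Section SecondMoment.
Variables (R : realType) (n m d q : nat).
Variable nu : {ffun half_edges m -> 'I_n}.
Hypothesis nu_reg : forall x, content nu x = d.+1.
Hypothesis hq : (d < q)%N.
Notation P := (half_edges m).

Lemma regular_size : (d.+1 * n = m * 2)%N.
Proof.
have := sum_content nu; rewrite card_prod card_ord card_bool => <-.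
under eq_bigr do rewrite nu_reg.
by rewrite sum_nat_const card_ord mulnC.
Qed.

Definition recolor (I : finType) (om : {ffun 'I_n -> I}) : {ffun P -> I} :=
  [ffun p => om (nu p)].

Lemma content_recolor (I : finType) (om : {ffun 'I_n -> I}) i :
  content (recolor om) i = (d.+1 * content om i)%N.
Proof.
rewrite !contentE big_distrr /= (partition_big nu xpredT) //=.
apply: eq_bigr => x _.
rewrite (eq_bigr (fun=> (om x == i : nat))) => [|p /eqP <-]; last by rewrite ffunE.
rewrite sum_nat_const -(nu_reg x) ffunE; congr (_ * _)%N.
by apply: eq_card => p; rewrite inE.
Qed.

Definition density (I : finType) (om : {ffun 'I_n -> I}) (i : I) : R :=
  (content om i)%:R / n%:R.

Hypothesis n0 : (0 < n)%N.

Lemma sum_density (I : finType) (om : {ffun 'I_n -> I}) : \sum_i density om i = 1.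
Proof.
rewrite -mulr_suml -natr_sum sum_content card_ord divff //.
by rewrite pnatr_eq0 -lt0n.
Qed.

(** The weights [a i ^+ d], where [a i ^+ d.+1] is the density of the colour [i],
    are chosen so that the [d.+1] powers of the density coming from the half-edges
    leave exactly one power, which is the one that the entropy of the colouring
    compensates in [sum_density_prod_le]. *)
Lemma card_all_pairs_recolor (I : finType) (A : rel I) (om : {ffun 'I_n -> I})
    (a : I -> R) : (forall i, 0 <= a i) ->
  (forall i, a i ^+ d.+1 = density om i) ->
  #|[set s | all_pairs A (shuffle (recolor om) s)]%SET|%:R <=
   (#|{: P}|)`!%:R * #|{: P}|.+1%:R ^+ #|I| * (\prod_i density om i ^+ content om i)
   * (\sum_u \sum_(v | A u v) a u ^+ d * a v ^+ d) ^+ m.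
Proof.
move=> a0 aE; set k := content (recolor om).
have kE i : k i = (d.+1 * content om i)%N by rewrite /k content_recolor.
have p0 i : 0 <= density om i by rewrite divr_ge0.
have PE : #|{: P}|%:R = d.+1%:R * n%:R :> R.
  by rewrite -natrM regular_size card_prod card_ord card_bool.
have P0 : 0 < #|{: P}|%:R :> R by rewrite PE mulr_gt0 // ltr0n.
have one : 1 <= #|{: P}|.+1%:R ^+ #|I| * (#|words P k|%:R * \prod_i density om i ^+ k i) :> R.
  rewrite -(ler_pM2l (exprn_gt0 #|{: P}| P0)) mulr1.
  apply: le_trans (@card_words_ge P I R k (sum_content _)) _.
  rewrite le_eqVlt; apply/orP; left; apply/eqP.
  have -> : \prod_i density om i ^+ k i = (#|{: P}|%:R ^+ #|{: P}|)^-1 * \prod_i (k i)%:R ^+ k i.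
    rewrite -exprVn -[X in _ ^+ X * _](sum_content (recolor om)) -/k -prodrXr -big_split /=.
    apply: eq_bigr => i _; rewrite -exprMn; congr (_ ^+ _).
    rewrite PE kE natrM /density; field.
    by rewrite nat1r !pnatr_eq0 -lt0n n0.
  by field; rewrite expf_neq0 ?gt_eqF.
set X := #|[set s | _]%SET|%:R.
apply: (@le_trans _ _ (X * (#|{: P}|.+1%:R ^+ #|I| * (#|words P k|%:R * \prod_i density om i ^+ k i)))).
  by rewrite ler_peMr.
have XE : X * #|words P k|%:R = (#|{: P}|)`!%:R *
    #|[set t in words P k | all_pairs A t]%SET|%:R.
  by rewrite -!natrM (card_shuffle_in (recolor om) (all_pairs A)).
rewrite [leLHS](_ : _ = #|{: P}|.+1%:R ^+ #|I| * (X * #|words P k|%:R) * \prod_i density om i ^+ k i); last ring.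
rewrite XE.
have -> : \prod_i density om i ^+ k i =
   (\prod_i density om i ^+ content om i) * \prod_i (a i ^+ d) ^+ k i.
  rewrite -big_split /=; apply: eq_bigr => i _.
  by rewrite kE -!aE -!exprM -exprD; congr (_ ^+ _); ring.
set D := \prod_i density om i ^+ content om i.
have D0 : 0 <= D by apply: prodr_ge0 => i _; exact: exprn_ge0.
have := @card_pairs_weight m I R A (fun i => a i ^+ d) k (fun i => exprn_ge0 _ (a0 i)).
set Y := _%:R * _ => hY.
rewrite [leLHS](_ : _ = (#|{: P}|)`!%:R * #|{: P}|.+1%:R ^+ #|I| * D * Y); last by rewrite /Y; ring.
by apply: ler_wpM2l hY; rewrite !mulr_ge0 ?exprn_ge0.
Qed.

(** Each of the at most [(n + 1) ^ #|I|] contents contributes the probability of a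
    set of words under its own product measure, hence at most [1]. *)
Lemma sum_density_prod_le (I : finType) :
  \sum_(om : {ffun 'I_n -> I}) \prod_i density om i ^+ content om i
    <= n.+1%:R ^+ #|I|.
Proof.
pose toK (t : {ffun 'I_n -> I}) : {ffun I -> 'I_n.+1} := [ffun i => inord (content t i)].
have toKE t i : toK t i = content t i :> nat.
  by rewrite ffunE inordK // ltnS -{2}(card_ord n) -(sum_content t) (bigD1 i) //= leq_addr.
rewrite (partition_big toK xpredT) //=.
apply: (@le_trans _ _ (\sum_(K : {ffun I -> 'I_n.+1}) 1)); last first.
  by rewrite sumr_const card_ffun card_ord -natrX.
apply: ler_sum => K _.
have [t0 /eqP t0K|none] := pickP (fun t => toK t == K); last by rewrite big_pred0.
have tl t : toK t == K -> content t = content t0.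
  by move=> /eqP tK; apply/ffunP => i; rewrite -!toKE tK t0K.
have p0 i : 0 <= density t0 i by rewrite divr_ge0.
have := @card_words_weight 'I_n I R (density t0) (content t0) p0.
rewrite sum_density expr1n; apply: le_trans.
have -> : \sum_(t | toK t == K) \prod_i density t i ^+ content t i
    = \sum_(t | toK t == K) \prod_i density t0 i ^+ content t0 i.
  by apply: eq_bigr => t /tl tE; apply: eq_bigr => i _; rewrite /density tE.
rewrite sumr_const -(mulr_natl (\prod_(i : I) _)); apply: ler_wpM2r.
  by rewrite prodr_ge0 // => i _; exact: exprn_ge0.
rewrite ler_nat; apply: subset_leq_card; apply/fintype.subsetP => t.
by rewrite in_words => /tl ->.
Qed.

Definition proper_on (C : eqType) (w : {ffun P -> 'I_n}) (f : {ffun 'I_n -> C}) : bool :=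
  [forall k, f (w (k, false)) != f (w (k, true))].

Definition word_colorings (w : {ffun P -> 'I_n}) : nat :=
  #|[set f : {ffun 'I_n -> 'I_q} | proper_on w f]%SET|.

(** The Bethe prediction for the number of colourings; see [ln_bethe] for its
    usual form. *)
Definition bethe : R := (q%:R * (q%:R - 1)) ^+ m / q%:R ^+ (n * d).

(** A pair of colourings is one colouring by pairs of colours, for the relation of
    differing in both coordinates.  Its quadratic form is bounded by
    [bilinear_neq2_le], where [rho ^+ d.+1 = q ^- 2] because the densities sum to
    one. *)
Lemma second_moment :
  \sum_(s : {perm P}) (word_colorings (shuffle nu s))%:R ^+ 2 <=
  (#|{: P}|)`!%:R * (#|{: P}|.+1%:R * n.+1%:R) ^+ (q ^ 2) * bethe ^+ 2 :> R.
Proof.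
pose C : finType := 'I_q.
pose A : rel (C * C) := fun u v => (u.1 != v.1) && (u.2 != v.2).
have q0 : 0 < q%:R :> R by rewrite ltr0n (leq_ltn_trans _ hq).
have q1 : 0 <= q%:R - 1 :> R by rewrite subr_ge0 ler1n (leq_ltn_trans _ hq).
have cCC : #|{: C * C}| = (q ^ 2)%N by rewrite card_prod card_ord mulnn.
have sq s : ((word_colorings (shuffle nu s)) ^ 2)%N =
   (\sum_(om : {ffun 'I_n -> C * C}) all_pairs A (shuffle (recolor om) s))%N.
  rewrite -mulnn /word_colorings -cardsX -sum1_card.
  pose f (om : {ffun 'I_n -> C * C}) := ([ffun x => (om x).1], [ffun x => (om x).2]).
  have fbij : bijective f.
    exists (fun u : {ffun 'I_n -> C} * {ffun 'I_n -> C} => [ffun x => (u.1 x, u.2 x)]) => [om|[g h]].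
      by apply/ffunP => x; rewrite !ffunE; case: (om x).
    by congr (_, _); apply/ffunP => x; rewrite !ffunE.
  rewrite (reindex f) /=; last exact: onW_bij fbij.
  rewrite big_mkcond /=; apply: eq_bigr => om _; rewrite !inE /=.
  rewrite (_ : _ && _ = all_pairs A (shuffle (recolor om) s)); first by case: ifP.
  rewrite /proper_on /all_pairs /A.
  apply/andP/forallP => [[/forallP h1 /forallP h2] k|h].
    by have := h1 k; have := h2 k; rewrite !ffunE => -> ->.
  by split; apply/forallP => k; have := h k; rewrite !ffunE => /andP[].
have -> : \sum_(s : {perm P}) (word_colorings (shuffle nu s))%:R ^+ 2 =
  \sum_(om : {ffun 'I_n -> C * C}) #|[set s | all_pairs A (shuffle (recolor om) s)]%SET|%:R :> R.
  under eq_bigr do rewrite -natrX sq.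
  rewrite -!natr_sum; congr _%:R; rewrite exchange_big /=; apply: eq_bigr => om _.
  by rewrite -sum1dep_card [RHS]big_mkcond /=; apply: eq_bigr => s _; case: ifP.
have [|rho rho0 rhoE] := @exists_root R d.+1 ((q%:R ^+ 2)^-1) (ltn0Sn d).
  by rewrite invr_ge0 exprn_ge0.
have bound (om : {ffun 'I_n -> C * C}) :
    #|[set s | all_pairs A (shuffle (recolor om) s)]%SET|%:R <=
    (#|{: P}|)`!%:R * #|{: P}|.+1%:R ^+ (q ^ 2) * bethe ^+ 2 *
    \prod_i density om i ^+ content om i :> R.
  have p0 i : 0 <= density om i by rewrite divr_ge0.
  have ex i : exists a, 0 <= a /\ a ^+ d.+1 = density om i.
    by have [a a0 aE] := @exists_root R d.+1 _ (ltn0Sn d) (p0 i); exists a.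
  have [a Ha] := choice ex.
  have a0 i : 0 <= a i by case: (Ha i).
  have aE i : a i ^+ d.+1 = density om i by case: (Ha i).
  apply: le_trans (card_all_pairs_recolor A a0 aE) _.
  rewrite cCC.
  set D := \prod_i _.
  have D0 : 0 <= D by apply: prodr_ge0 => i _; exact: exprn_ge0.
  rewrite [leRHS](_ : _ = (#|{: P}|)`!%:R * #|{: P}|.+1%:R ^+ (q ^ 2) * D * bethe ^+ 2); last ring.
  apply: ler_wpM2l; first by rewrite !mulr_ge0 ?exprn_ge0.
  have hC : (d < #|C|)%N by rewrite card_ord.
  have := @bilinear_neq2_le R C d hC a rho a0 rho0.
  rewrite card_ord rhoE mulfV ?expf_neq0 ?gt_eqF // => H.
  have {}H := H _.
  have sa : 1 = \sum_u a u ^+ d.+1.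
    by under eq_bigr do rewrite aE; rewrite sum_density.
  have {H sa} := H sa.
  have Z0 : 0 <= \sum_u \sum_(v | A u v) a u ^+ d * a v ^+ d.
    by apply: sumr_ge0 => u _; apply: sumr_ge0 => v _; rewrite mulr_ge0 ?exprn_ge0.
  move=> H; apply: (@le_trans _ _ (((q%:R * (q%:R - 1)) ^+ 2 * (rho ^+ d) ^+ 2) ^+ m)).
    by rewrite lerXn2r // nnegrE ?Z0 // mulr_ge0 // exprn_ge0 // ?mulr_ge0 // exprn_ge0.
  rewrite le_eqVlt; apply/orP; left; apply/eqP.
  rewrite /bethe exprMn -!exprM expr_div_n -!exprM [(2 * m)%N]mulnC; congr (_ * _).
  rewrite (_ : (d * 2 * m = d.+1 * (n * d))%N); last by rewrite mulnA regular_size; ring.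
  by rewrite exprM rhoE exprVn -exprM mulnC.
apply: le_trans (ler_sum _ (fun om _ => bound om)) _.
rewrite -mulr_sumr.
have := sum_density_prod_le (C * C)%type; rewrite cCC => h.
apply: le_trans (ler_wpM2l _ h) _; first by apply: mulr_ge0 (sqr_ge0 _); rewrite mulr_ge0 ?exprn_ge0.
by rewrite [in leRHS]exprMn mulrAC !mulrA lexx.
Qed.
End SecondMoment.

(** * The first moment *)

Lemma sum_ord_eq (q c e : nat) : (\sum_(y < q) (y == c :> nat) * e = (c < q) * e)%N.
Proof.
rewrite -big_distrl /=; congr (_ * _)%N.
have [cq|cq] := ltnP c q.
  by rewrite (bigD1 (Ordinal cq)) //= eqxx big1 // => y /negPf yc; rewrite -[y == c :> nat]/(y == Ordinal cq) yc.
by rewrite big1 // => y _; case: eqP => // yc; have := ltn_ord y; rewrite yc ltnNge cq.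
Qed.

(** A bound on the deviation from perfect balance in [balanced_profile]. *)
Definition imbalance (r q : nat) : nat := (q * q * (r * (2 * (q * q) + 2)))%N.

(** Divisibility is the only obstacle to using all colours, and all ordered pairs
    of distinct colours, equally often.  Write [n = D * b + j] with
    [D = 2 q (q - 1)] and [2 <= j].  The first [D * b] nodes are perfectly
    balanced.  The last [j] nodes are coloured by [0] and [1] in equal numbers,
    with one node of colour [2] if [j] is odd; then [r] is even, and half of the
    edges of that node go to each of the colours [0] and [1]. *)
Lemma balanced_profile (r q n m : nat) : (0 < r)%N -> (r < q)%N -> (1 < n)%N ->
  (r * n = m * 2)%N ->
  exists (ka : {ffun 'I_q -> nat}) (mu : {ffun 'I_q * 'I_q -> nat}),
  [/\ (\sum_i ka i)%N = n /\ (\sum_u mu u)%N = m,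
      forall i, (q * ka i <= n + imbalance r q)%N,
      forall u, (q * q.-1 * mu u <= m + imbalance r q)%N,
      forall i, mu (i, i) = 0%N
    & forall i, (\sum_j (mu (i, j) + mu (j, i)) = r * ka i)%N].
Proof.
move=> r0 rq n1 rn.
have [D DE] : exists D, D = (2 * (q * q.-1))%N by exists (2 * (q * q.-1))%N.
have D0 : (0 < D)%N by rewrite DE; nia.
pose b := ((n - 2) %/ D)%N; pose j := ((n - 2) %% D + 2)%N.
have nE : n = (D * b + j)%N.
  by rewrite /j addnA [(D * b)%N]mulnC -divn_eq subnK.
have jD : (j <= D + 1)%N by rewrite /j; have := ltn_pmod (n - 2) D0; lia.
have j2 : (2 <= j)%N by rewrite /j; lia.
clearbody b j.
set h := j./2; set ep := odd j.
have jE : j = (ep + h * 2)%N by rewrite -[LHS]odd_double_half muln2.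
set e2 := (ep * r./2)%N; set e1 := (r * h - e2)%N.
have D2 : odd D = false by rewrite DE oddM.
have rj : ~~ odd (r * j).
  have : ~~ odd (r * n) by rewrite rn oddM andbF.
  by rewrite nE mulnDr oddD !oddM D2 !andbF.
have re : (e2 * 2 = ep * r)%N.
  rewrite /e2 -mulnA; move: rj; rewrite oddM -/ep; case: (ep) => //=; rewrite andbT => /negPf ro.
  by rewrite !mul1n muln2 -[RHS]odd_double_half ro.
have qq : (q * q.-1 <= q * q)%N by rewrite leq_mul2l leq_pred orbT.
have hle : (h <= 2 * (q * q) + 2)%N.
  by move: qq jD jE; rewrite DE; move: (q * q)%N (q * q.-1)%N; lia.
have h1 : (1 <= h)%N by move: jE j2; case: (ep); lia.
have e2le : (e2 <= r * h)%N by have := re; case: (ep) => /=; nia.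
have e1E : (e1 + e2 = r * h)%N by rewrite /e1 subnK.
have q2 : (1 < q)%N by lia.
have epq : (2 < q)%N || (e2 == 0%N).
  have [//|q3] := ltnP 2 q; have r1 : r = 1%N by lia.
  by rewrite /e2 r1 muln0 eqxx.
have epq' : (2 < q)%N || (ep == false).
  have [//|q3] := ltnP 2 q; have r1 : r = 1%N by lia.
  by move: rj; rewrite r1 mul1n => /negPf; rewrite /ep => ->.
pose ex (x y : nat) := ((x == 0) * ((y == 1) * e1) + (x < 2) * ((y == 2) * e2))%N.
pose mu : {ffun 'I_q * 'I_q -> nat} := [ffun u : 'I_q * 'I_q => if u.1 == u.2 then 0%N else (r * b + ex u.1 u.2)%N].
pose ka : {ffun 'I_q -> nat} := [ffun x : 'I_q => (2 * q.-1 * b + ((x < 2) * h + (x == 2 :> nat) * ep))%N].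
have exx x : ex x x = 0%N by rewrite /ex; case: x => [|[|[|x]]] /=; lia.
have muE x y : mu (x, y) = ((x != y) * (r * b) + ex x y)%N.
  by rewrite ffunE /=; case: eqP => [->|_]; rewrite ?exx ?mul1n.
have s1 (i : 'I_q) : (\sum_(y < q) ex i y = (i == 0 :> nat) * e1 + (i < 2) * e2)%N.
    rewrite /ex big_split /= -!big_distrr /= !sum_ord_eq q2 mul1n; congr (_ + _)%N.
    by case/orP: epq => [->|/eqP ->]; rewrite ?mul1n ?muln0.
have s2 (i : 'I_q) : (\sum_(y < q) ex y i = (i == 1 :> nat) * e1 + (i == 2 :> nat) * (e2 * 2))%N.
    rewrite /ex big_split /= sum_ord_eq (ltnW q2) mul1n; congr (_ + _)%N.
    rewrite -big_distrl /= mulnC -mulnA; congr (_ * (_ * _))%N.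
    have lt2 (y : nat) : (y < 2)%N = ((y == 0) * 1 + (y == 1) * 1)%N :> nat.
      by case: y => [|[|y]].
    by under eq_bigr do rewrite lt2; rewrite big_split /= !sum_ord_eq q2 (ltnW q2).
have exle (x y : nat) : (ex x y <= r * (2 * (q * q) + 2))%N.
  have : (ex x y <= e1 + e2)%N.
    by rewrite /ex; case: x => [|[|x']]; case: y => [|[|[|y']]] /=; lia.
  by rewrite e1E => /leq_trans-> //; rewrite leq_mul2l hle orbT.
clearbody mu ex.
have deg i : (\sum_j (mu (i, j) + mu (j, i)) = r * ka i)%N.
  have sum_ne : (\sum_(y : 'I_q) (i != y) * (r * b) = q.-1 * (r * b))%N.
    rewrite -big_distrl /=; congr (_ * _)%N.
    rewrite (bigD1 i) //= eqxx add0n (eq_bigr (fun=> 1%N)) => [|y]; last by rewrite eq_sym => ->.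
    by rewrite sum1_card cardC1 card_ord.
  under eq_bigr do rewrite !muE.
  rewrite !big_split /= sum_ne s1 s2.
  under eq_bigr do rewrite eq_sym.
  rewrite sum_ne ffunE re.
  rewrite [RHS]mulnDr; have := e1E; move: re; case: (val i) => [|[|[|y]]] /=; lia.
have ka_sum : (\sum_i ka i = n)%N.
  under eq_bigr do rewrite ffunE.
  have lt2 (y : nat) : (y < 2)%N = ((y == 0) * 1 + (y == 1) * 1)%N :> nat.
    by case: y => [|[|y]].
  rewrite !big_split /= sum_nat_const card_ord sum_ord_eq -big_distrl /=.
  under eq_bigr do rewrite lt2.
  rewrite big_split /= !sum_ord_eq q2 (ltnW q2) nE jE DE.
  by case/orP: epq' => [->|/eqP ->]; lia.
have mu_sum : (\sum_u mu u = m)%N.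
  apply/eqP; rewrite -(eqn_pmul2r (isT : 0 < 2)%N) -rn -ka_sum big_distrr /=.
  rewrite (eq_bigr _ (fun i _ => esym (deg i))); apply/eqP.
  under [RHS]eq_bigr do rewrite big_split.
  rewrite big_split /= [X in (_ = _ + X)%N]exchange_big /= !pair_big /=.
  by rewrite muln2 -addnn; congr (_ + _)%N; apply: eq_bigr => -[].
exists ka, mu; split => //.
- move=> i; rewrite ffunE nE DE /imbalance mulnDr.
  set z := ((i < 2) * h + _)%N.
  have zh : (z <= h + 1)%N.
    by rewrite /z; move: h1; case: (val i) => [|[|[|y]]] /=; case: (ep); lia.
  have zj : (z <= j)%N by rewrite jE /z; move: h1; case: (val i) => [|[|[|y]]] /=; lia.
  have zle : (z <= 2 * (q * q) + 2)%N.
    by move: qq jD zj; rewrite DE; move: (q * q)%N (q * q.-1)%N; lia.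
  rewrite -addnA; apply: leq_add; first by rewrite leq_eqVlt; apply/orP; left; apply/eqP; ring.
  rewrite (leq_trans _ (leq_addl _ _)) // -mulnA leq_mul2l; apply/orP; right.
  apply: (leq_trans zle); rewrite [X in (_ <= X)%N]mulnA leq_pmull // muln_gt0 r0 andbT; lia.
- move=> [x y]; rewrite muE.
  have mge : (q * q.-1 * (r * b) <= m)%N.
    rewrite -(leq_pmul2r (isT : 0 < 2)%N) -rn nE DE mulnDr.
    rewrite (leq_trans _ (leq_addr _ _)) //.
    by rewrite leq_eqVlt; apply/orP; left; apply/eqP; ring.
  rewrite mulnDr; apply: leq_add; last by rewrite /imbalance leq_mul.
  apply: leq_trans mge; rewrite leq_mul2l.
  by case: (x != y); rewrite ?mul1n ?mul0n ?leqnn ?orbT.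
- by move=> i; rewrite muE eqxx exx.
Qed.

Section FirstMoment.
Variables (R : realType) (n m d q : nat).
Variable nu : {ffun half_edges m -> 'I_n}.
Hypothesis nu_reg : forall x, content nu x = d.+1.
Hypothesis hq : (d.+1 < q)%N.
Hypothesis n1 : (1 < n)%N.
Notation P := (half_edges m).

Lemma content_of_pairs (I : finType) (u : {ffun 'I_m -> I * I}) i :
  content (of_pairs u) i = (\sum_j (content u (i, j) + content u (j, i)))%N.
Proof.
transitivity (\sum_k \sum_(b : bool) (of_pairs u (k, b) == i))%N.
  by rewrite pair_bigA contentE; apply: eq_bigr => -[].
rewrite [RHS]big_split /=.
under eq_bigr do rewrite big_bool !ffunE /= addnC.
rewrite big_split /=; congr (_ + _)%N; under [RHS]eq_bigr do rewrite contentE;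
  rewrite exchange_big /=; apply: eq_bigr => k _.
  rewrite (bigD1 (u k).2) //= big1 ?addn0; last first.
    by move=> j /negPf h; rewrite -pair_eqE /pair_eq /= [_ == j]eq_sym h andbF.
  by rewrite -pair_eqE /pair_eq /= eqxx andbT.
rewrite (bigD1 (u k).1) //= big1 ?addn0; last first.
  by move=> j /negPf h; rewrite -pair_eqE /pair_eq /= [_ == j]eq_sym h.
by rewrite -pair_eqE /pair_eq /= eqxx.
Qed.

(** Only colourings with the content [ka] are counted, on shuffles in which the
    ordered pair of colours [u] occurs [mu u] times. *)
Lemma first_moment :
  (#|{: P}|)`!%:R * bethe R n m d q <=
  n.+1%:R ^+ q * m.+1%:R ^+ (q ^ 2) * expR (imbalance d.+1 q)%:R ^+ 2 *
  \sum_(s : {perm P}) (word_colorings q (shuffle nu s))%:R :> R.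
Proof.
set C := imbalance d.+1 q.
have rn := regular_size nu_reg.
have [ka [mu [[ka_sum mu_sum] kaC muC mu0 deg]]] :=
  balanced_profile (ltn0Sn d) hq n1 rn.
have q0 : 0 < q%:R :> R by rewrite ltr0n (leq_ltn_trans _ hq).
have hka := @card_words_balanced_ge 'I_n 'I_q R ka q C.
have {}hka := hka (etrans ka_sum (esym (card_ord n))).
have {}hka : q%:R ^+ n <= n.+1%:R ^+ q * #|words 'I_n ka|%:R * expR C%:R :> R.
  by move: hka; rewrite !card_ord; apply.
have hmu := @card_words_balanced_ge 'I_m ('I_q * 'I_q)%type R mu (q * q.-1)%N C.
have {}hmu := hmu (etrans mu_sum (esym (card_ord m))).
have {}hmu : (q * q.-1)%:R ^+ m <= m.+1%:R ^+ (q ^ 2) * #|words 'I_m mu|%:R * expR C%:R :> R.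
  by move: hmu; rewrite card_prod !card_ord mulnn; apply.
pose neq : rel 'I_q := fun x y => x != y.
have one (f : {ffun 'I_n -> 'I_q}) : f \in words 'I_n ka ->
    ((#|{: P}|)`! * #|words 'I_m mu| <=
    #|[set s | all_pairs neq (shuffle (recolor nu f) s)]%SET| * q ^ (m * 2))%N.
  move=> fk; have /eqP fE : content f == ka by rewrite -in_words.
  apply: (@leq_trans (#|[set s | all_pairs neq (shuffle (recolor nu f) s)]%SET| *
      #|words P (content (recolor nu f))|)); last first.
    rewrite leq_mul2l; apply/orP; right.
    have <- : #|{ffun P -> 'I_q}| = (q ^ (m * 2))%N.
      by rewrite card_ffun card_prod !card_ord card_bool.
    exact: max_card.
  rewrite card_shuffle_in leq_mul2l; apply/orP; right.
  rewrite -(card_imset _ (bij_inj (of_pairs_bij _ _))); apply: subset_leq_card.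
  apply/fintype.subsetP => _ /imsetP[u + ->]; rewrite in_words => /eqP uE.
  rewrite inE in_words; apply/andP; split.
    apply/eqP/ffunP => i; rewrite content_of_pairs (content_recolor nu_reg) fE -deg.
    by apply: eq_bigr => j _; rewrite uE.
  apply/forallP => k; rewrite /neq !ffunE /=; apply/eqP => e.
  have := mu0 (u k).1; rewrite -uE contentE (bigD1 k) //=.
  by rewrite {2}e -surjective_pairing eqxx.
have total : \sum_(s : {perm P}) (word_colorings q (shuffle nu s))%:R =
   \sum_(f : {ffun 'I_n -> 'I_q})
     #|[set s | all_pairs neq (shuffle (recolor nu f) s)]%SET|%:R :> R.
  rewrite -!natr_sum; congr _%:R; rewrite /word_colorings.
  transitivity (\sum_(s : {perm P}) \sum_(f : {ffun 'I_n -> 'I_q}) (proper_on (shuffle nu s) f))%N.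
    by apply: eq_bigr => s _; rewrite -sum1dep_card big_mkcond /=; apply: eq_bigr => f _; case: ifP.
  rewrite exchange_big /=; apply: eq_bigr => f _.
  rewrite -sum1dep_card [RHS]big_mkcond /=; apply: eq_bigr => s _.
  rewrite (_ : proper_on _ _ = all_pairs neq (shuffle (recolor nu f) s)); first by case: ifP.
  by apply: eq_forallb => k; rewrite /neq !ffunE.
have lower : (#|{: P}|)`!%:R * #|words 'I_m mu|%:R * #|words 'I_n ka|%:R <=
   q%:R ^+ (m * 2) * \sum_(s : {perm P}) (word_colorings q (shuffle nu s))%:R :> R.
  rewrite total mulr_sumr (bigID (fun f => f \in words 'I_n ka)) /=.
  rewrite -[leLHS]addr0; apply: lerD; last first.
    by apply: sumr_ge0 => f _; rewrite mulr_ge0 ?exprn_ge0.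
  rewrite mulr_natr -sumr_const; apply: ler_sum => f fk.
  by rewrite -natrX -!natrM ler_nat [leqRHS]mulnC; exact: one.
set S := \sum_(s : {perm P}) _ in lower *.
have S0 : 0 <= S by apply: sumr_ge0.
have bE : bethe R n m d q * q%:R ^+ (m * 2) = q%:R ^+ n * (q * q.-1)%:R ^+ m.
  rewrite /bethe -rn [(d.+1 * n)%N]mulSn exprD [(d * n)%N]mulnC natrM.
  rewrite -subn1 natrB; last by rewrite (leq_trans _ (ltnW hq)).
  by field; rewrite expf_neq0 // gt_eqF.
have qm0 : 0 < q%:R ^+ (m * 2) :> R by rewrite exprn_gt0.
rewrite -(ler_pM2r qm0) -[leLHS]mulrA bE -[leRHS]mulrA [S * _]mulrC.
have e0 : 0 <= expR C%:R :> R by apply: expR_ge0.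
apply: (@le_trans _ _ ((#|{: P}|)`!%:R * ((n.+1%:R ^+ q * #|words 'I_n ka|%:R * expR C%:R) *
   (m.+1%:R ^+ (q ^ 2) * #|words 'I_m mu|%:R * expR C%:R)))).
  by apply: ler_wpM2l => //; apply: ler_pM => //; apply: exprn_ge0.
set A := n.+1%:R ^+ q; set B := m.+1%:R ^+ (q ^ 2).
rewrite [leLHS](_ : _ = A * B * expR C%:R ^+ 2 *
  ((#|{: P}|)`!%:R * #|words 'I_m mu|%:R * #|words 'I_n ka|%:R)); last ring.
apply: ler_wpM2l => //.
by rewrite !mulr_ge0 ?exprn_ge0.
Qed.
End FirstMoment.

(** * Concentration for functions of a random permutation *)

Lemma expR_le_quad (R : realType) (y : R) : y <= 2^-1 -> expR y <= 1 + y + 2 * y ^+ 2.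
Proof.
move=> hy.
have y1 : 0 < 1 - y by lra.
have h : expR y <= (1 - y)^-1.
  rewrite -[y in leLHS]opprK expRN lef_pV2 ?posrE ?expR_gt0 //.
  by have := expR_ge1Dx (- y); rewrite /=.
apply: le_trans h _; rewrite -[leLHS]mul1r ler_pdivrMr //.
have := sqr_ge0 y; nra.
Qed.

(** The one-step estimate of the martingale argument; the first order term
    disappears because [z] is centred. *)
Lemma sum_expR_centered (R : realType) (X : finType) (A : {set X}) (z : X -> R) (a : R) :
  a <= 2^-1 -> (forall x, x \in A -> `|z x| <= a) -> \sum_(x in A) z x = 0 ->
  \sum_(x in A) expR (z x) <= #|A|%:R * expR (2 * a ^+ 2).
Proof.
move=> a2 za z0.
apply: (@le_trans _ _ (\sum_(x in A) (z x + (1 + 2 * a ^+ 2)))).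
  apply: ler_sum => x xA; have zx := za x xA.
  apply: le_trans (expR_le_quad _) _; first by rewrite (le_trans _ a2) // (le_trans _ zx) // ler_norm.
  have : z x ^+ 2 <= a ^+ 2.
    by rewrite -[z x ^+ 2]real_normK ?num_real // lerXn2r ?nnegrE // (le_trans _ zx).
  lra.
rewrite big_split /= z0 add0r sumr_const -(mulr_natl (1 + _)); apply: ler_wpM2l => //.
exact: expR_ge1Dx.
Qed.

Section Concentration.
Variables (R : realType) (P : finType) (f : {perm P} -> R) (c : R).
Hypothesis f_lip : forall s x y, `|f (s * tperm x y)%g - f s| <= c.

Definition average (A : {set {perm P}}) : R := (\sum_(s in A) f s) / #|A|%:R.

(** The atoms of the filtration that reveals a permutation one value at a time. *)
Definition agreeing (D : {set P}) (u : {perm P}) : {set {perm P}} :=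
  [set s : {perm P} | [forall p in D, s p == u p]]%SET.

Lemma agreeingP (D : {set P}) (u s : {perm P}) : reflect (forall p, p \in D -> s p = u p) (s \in agreeing D u).
Proof. by rewrite inE; apply: (iffP forall_inP) => h p /h /eqP. Qed.

(** Exchanging two values maps one atom onto another, so that neighbouring atoms
    have almost the same average. *)
Lemma average_swap (A B : {set {perm P}}) x y : (0 < #|A|)%N ->
  (fun s => (s * tperm x y)%g) @: A = B ->
  #|A| = #|B| /\ `|average A - average B| <= c.
Proof.
move=> A0 AB.
have inj : injective (fun s : {perm P} => (s * tperm x y)%g) by apply: mulIg.
have cE : #|A| = #|B| by rewrite -AB card_imset.
split=> //; rewrite /average -cE -mulrBl -AB big_imset /=; last by move=> ? ? _ _; apply: inj.
have cA : 0 < #|A|%:R :> R by rewrite ltr0n.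
rewrite normrM [`|_^-1|]ger0_norm ?invr_ge0 // ler_pdivrMr // -sumrB.
apply: le_trans (ler_norm_sum _ _ _) _.
rewrite mulr_natr -sumr_const; apply: ler_sum => s _.
by rewrite distrC f_lip.
Qed.

(** Azuma's inequality, by induction on the number [k] of values not yet revealed:
    revealing the value at [p] splits the atom into equally large atoms [Ax x],
    whose averages [mx x] pairwise differ by at most [c]. *)
Lemma mgf_agreeing (lam : R) : `|lam| * c <= 2^-1 -> forall k (D : {set P}) u, #|~: D| = k ->
  \sum_(s in agreeing D u) expR (lam * (f s - average (agreeing D u)))
   <= #|agreeing D u|%:R * expR (2 * (lam * c) ^+ 2) ^+ k.
Proof.
move=> lc; elim=> [|k IH] D u Dk.
  have -> : agreeing D u = [set u]%SET.
    have DT p : p \in D by have := cards0_eq Dk => /setP/(_ p); rewrite !inE => /negbFE.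
    apply/setP => s; rewrite [RHS]inE; apply/agreeingP/eqP => [h|-> //].
    by apply/permP => p; apply: h.
  by rewrite big_set1 cards1 /average big_set1 cards1 divr1 subrr mulr0 expR0 expr0 mulr1.
have [p pD] : exists p, p \in ~: D by apply/card_gt0P; rewrite Dk.
rewrite inE in pD.
set A := agreeing D u.
have uA : u \in A by apply/agreeingP.
have A0 : (0 < #|A|)%N by apply/card_gt0P; exists u.
pose Ax x := [set s in A | s p == x]%SET.
pose X := [set x | (0 < #|Ax x|)%N]%SET.
have AxE s : s \in A -> Ax (s p) = agreeing (p |: D) s.
  move=> /agreeingP sA; apply/setP => t; rewrite inE; apply/andP/agreeingP.
    by move=> [/agreeingP tA /eqP tp] p'; rewrite !inE => /orP[/eqP ->//|p'D]; rewrite tA // sA.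
  move=> h; split; last by rewrite h // !inE eqxx.
  by apply/agreeingP => p' p'D; rewrite h ?sA // !inE p'D orbT.
have swap x y : x \in X -> y \in X -> (fun s => (s * tperm x y)%g) @: Ax x = Ax y.
  rewrite !inE => /card_gt0P[sx]; rewrite inE => /andP[/agreeingP sxA /eqP sxp].
  move=> /card_gt0P[sy]; rewrite inE => /andP[/agreeingP syA /eqP syp].
  have fixD p' : p' \in D -> tperm x y (u p') = u p'.
    move=> p'D; rewrite tpermD //.
      by rewrite -(sxA _ p'D) -sxp; apply: contraNneq pD => /perm_inj ->.
    by rewrite -(syA _ p'D) -syp; apply: contraNneq pD => /perm_inj ->.
  apply/setP => t; apply/imsetP/idP => [[s]|].
    rewrite [s \in _]inE => /andP[/agreeingP sA /eqP sp] ->; rewrite inE permM sp tpermL eqxx andbT.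
    by apply/agreeingP => p' p'D; rewrite permM sA // fixD.
  rewrite inE => /andP[/agreeingP tA /eqP tp]; exists (t * tperm x y)%g; last first.
    by rewrite -mulgA tperm2 mulg1.
  rewrite inE permM tp tpermR eqxx andbT.
  by apply/agreeingP => p' p'D; rewrite permM tA // fixD.
have upX : u p \in X by rewrite inE; apply/card_gt0P; exists u; rewrite inE uA eqxx.
pose K := #|Ax (u p)|; pose mx x := average (Ax x).
have Ax0 x : x \in X -> (0 < #|Ax x|)%N by rewrite inE.
have cAx x : x \in X -> #|Ax x| = K.
  by move=> xX; have [] := average_swap (Ax0 _ xX) (swap _ _ xX upX).
have dm x y : x \in X -> y \in X -> `|mx x - mx y| <= c.
  by move=> xX yX; have [] := average_swap (Ax0 _ xX) (swap _ _ xX yX).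
have part (g : {perm P} -> R) : \sum_(s in A) g s = \sum_(x in X) \sum_(s in Ax x) g s.
  rewrite (partition_big (fun s : {perm P} => s p) (fun x => x \in X)) /=; last first.
    by move=> s sA; rewrite inE; apply/card_gt0P; exists s; rewrite inE sA eqxx.
  by apply: eq_bigr => x _; apply: eq_bigl => s; rewrite [RHS]inE.
have X0 : 0 < #|X|%:R :> R by rewrite ltr0n; apply/card_gt0P; exists (u p).
have K0 : 0 < K%:R :> R by rewrite ltr0n Ax0.
have cA : #|A|%:R = #|X|%:R * K%:R :> R.
  have := part (fun=> 1); rewrite sumr_const => ->.
  rewrite mulr_natl -sumr_const; apply: eq_bigr => x xX.
  by rewrite sumr_const cAx.
have meanE : average A = (\sum_(x in X) mx x) / #|X|%:R.
  rewrite /average part cA.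
  have -> : \sum_(x in X) mx x = (\sum_(x in X) \sum_(s in Ax x) f s) / K%:R.
    by rewrite mulr_suml; apply: eq_bigr => x xX; rewrite /mx /average cAx.
  by rewrite invfM mulrA mulrAC.
have devX x : x \in X -> `|mx x - average A| <= c.
  move=> xX; have -> : mx x - average A = (\sum_(y in X) (mx x - mx y)) / #|X|%:R.
    by rewrite sumrB sumr_const meanE -(mulr_natr (mx x)) mulrBl mulfK // gt_eqF.
  rewrite normrM [`|_^-1|]ger0_norm ?invr_ge0 // ler_pdivrMr //.
  apply: le_trans (ler_norm_sum _ _ _) _.
  by rewrite mulr_natr -sumr_const; apply: ler_sum => y yX; apply: dm.
have inner x : x \in X ->
   \sum_(s in Ax x) expR (lam * (f s - average A)) <=
   expR (lam * (mx x - average A)) * (K%:R * expR (2 * (lam * c) ^+ 2) ^+ k).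
  move=> xX; have /card_gt0P[s0] := Ax0 _ xX; rewrite inE => /andP[s0A /eqP s0p].
  have E : Ax x = agreeing (p |: D) s0 by rewrite -s0p AxE.
  have cD : #|~: (p |: D)| = k.
    have := cardsC (p |: D); have := cardsC D; rewrite Dk cardsU1 pD /=; lia.
  have := IH _ s0 cD; rewrite -E cAx // -/(mx x) => h.
  apply: le_trans (ler_wpM2l (expR_ge0 _) h).
  rewrite mulr_sumr; apply: ler_sum => s _; rewrite -expRD -mulrDr.
  by rewrite [X in _ <= expR (lam * X)](_ : _ = f s - average A) //; ring.
rewrite part; apply: le_trans (ler_sum _ inner) _.
rewrite -mulr_suml.
have := @sum_expR_centered R P X (fun x => lam * (mx x - average A)) (`|lam| * c) lc.
rewrite exprMn real_normK ?num_real // -exprMn => H.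
have {}H : \sum_(x in X) expR (lam * (mx x - average A)) <= #|X|%:R * expR (2 * (lam * c) ^+ 2).
  apply: H.
    by move=> x xX; rewrite normrM; apply: ler_wpM2l (devX x xX).
  by rewrite -mulr_sumr sumrB sumr_const -[average A *+ _]mulr_natr meanE divfK ?gt_eqF // subrr mulr0.
have B0 : 0 <= K%:R * expR (2 * (lam * c) ^+ 2) ^+ k by rewrite mulr_ge0 // exprn_ge0 // expR_ge0.
apply: le_trans (ler_wpM2r B0 H) _.
by rewrite cA [_ ^+ k.+1]exprS mulrACA.
Qed.

Definition mean : R := average [set: {perm P}]%SET.

Lemma shuffle_mgf (lam : R) : `|lam| * c <= 2^-1 ->
  \sum_s expR (lam * (f s - mean)) <= (#|P|)`!%:R * expR (2 * (lam * c) ^+ 2) ^+ #|P|.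
Proof.
move=> lc.
have := @mgf_agreeing lam lc #|P| finset.set0 1%g.
have -> : agreeing finset.set0 1%g = [set: {perm P}]%SET.
  by apply/setP => s; rewrite [RHS]inE; apply/agreeingP => p; rewrite inE.
rewrite finset.setC0 !cardsT card_perms => /(_ erefl); apply: le_trans.
by rewrite le_eqVlt; apply/orP; left; apply/eqP/eq_bigl => s; rewrite inE.
Qed.

Lemma shuffle_tail (lam t : R) : `|lam| * c <= 2^-1 ->
  #|[set s | t <= lam * (f s - mean)]%SET|%:R <=
    (#|P|)`!%:R * expR (2 * (lam * c) ^+ 2) ^+ #|P| * expR (- t).
Proof.
move=> lc; rewrite expRN -ler_pdivrMr ?invr_gt0 ?expR_gt0 // invrK.
apply: le_trans (shuffle_mgf lc).
rewrite (bigID (fun s => t <= lam * (f s - mean))) /=.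
rewrite -[leLHS]addr0; apply: lerD; last by apply: sumr_ge0 => s _; apply: expR_ge0.
rewrite mulr_natl -sumr_const [leLHS](eq_bigl (fun s => t <= lam * (f s - mean))); last first.
  by move=> s; rewrite inE.
by apply: ler_sum => s; rewrite ler_expR.
Qed.
End Concentration.

(** * The logarithm of the number of colourings is Lipschitz *)

Section Lipschitz.
Variables (n m q : nat).
Notation P := (half_edges m).
Implicit Types (w : {ffun P -> 'I_n}) (K : {set 'I_m}) (g : {ffun 'I_n -> 'I_q}).

(** Colourings that respect the pairs in [K], with loops ignored: unlike the
    number of proper colourings, their number cannot vanish when all degrees are
    below [q]. *)
Definition loose_proper K w g : bool :=
  [forall k in K, (w (k, false) == w (k, true)) || (g (w (k, false)) != g (w (k, true)))].

Definition loose_colorings K w : nat := #|[set g | loose_proper K w g]%SET|.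

Lemma loose_colorings_mono K K' w :
  K \subset K' -> (loose_colorings K' w <= loose_colorings K w)%N.
Proof.
move=> KK; apply: subset_leq_card; apply/fintype.subsetP => g; rewrite !inE.
by move=> /forall_inP h; apply/forall_inP => k kK; apply/h/(fintype.subsetP KK).
Qed.

(** The node [u] has at most [r < q] half-edges, so a colouring that only violates
    the pair [k] can be repaired by recolouring [u].  The repaired colouring
    determines the original one, in which [u] has the colour of the other end of
    [k]. *)
Lemma loose_colorings_remove K k w r :
  (forall x, content w x <= r)%N -> (r < q)%N ->
  (loose_colorings (K :\ k) w <= 2 * loose_colorings K w)%N.
Proof.
move=> wr rq; set u := w (k, false); set v := w (k, true).
pose S := [set g | loose_proper K w g]%SET.
pose S' := [set g | loose_proper (K :\ k) w g]%SET.
have SS' : S \subset S'.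
  apply/fintype.subsetP => g; rewrite !inE => /forall_inP h; apply/forall_inP => j.
  by rewrite in_setD1 => /andP[_ jK]; apply: h.
rewrite /loose_colorings -/S -/S' -(cardsID S S') (finset.setIidPr SS') mul2n -addnn leq_add2l.
pose mate (p : P) : P := (p.1, ~~ p.2).
pose F g := [set g (w (mate p)) | p in [set p | w p == u]%SET]%SET.
pose recol g : {ffun 'I_n -> 'I_q} :=
  [ffun x => if x == u then odflt (g u) [pick c | c \notin F g] else g x].
have recolu g : recol g u \notin F g.
  rewrite ffunE eqxx; case: pickP => //= none.
  have : (#|F g| < #|'I_q|)%N.
    rewrite card_ord (leq_ltn_trans _ rq) // (leq_trans (leq_imset_card _ _)) //.
    by have := wr u; rewrite ffunE.
  rewrite ltnNge => /negP[]; apply: subset_leq_card; apply/fintype.subsetP => c _.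
  by have := none c => /negbFE.
have recolE g x : x != u -> recol g x = g x by move=> /negPf xu; rewrite ffunE xu.
have bad g : g \in S' :\: S -> u != v /\ g u = g v.
  rewrite !inE => /andP[/forall_inPn[j jK] + /forall_inP h].
  have [->|jk] := eqVneq j k; first by rewrite negb_or negbK => /andP[? /eqP].
  by rewrite h // in_setD1 jk.
have inj : {in S' :\: S &, injective recol}.
  move=> g1 g2 /bad[uv e1] /bad[_ e2] /ffunP e.
  have ev : g1 v = g2 v by have := e v; rewrite !recolE // eq_sym.
  apply/ffunP => x; have [->|xu] := eqVneq x u; first by rewrite e1 e2.
  by have := e x; rewrite !recolE.
rewrite -(card_in_imset inj); apply: subset_leq_card.
apply/fintype.subsetP => _ /imsetP[g gS ->]; have [uv guv] := bad _ gS.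
rewrite inE; apply/forall_inP => j jK.
have Fmem p : w p = u -> g (w (mate p)) \in F g.
  by move=> wp; apply/imsetP; exists p => //; rewrite inE wp.
have [ju|ju] := eqVneq (w (j, false)) u.
  have [//|jl /=] := eqVneq (w (j, false)) (w (j, true)).
  rewrite ju (recolE g (w (j, true))); last by rewrite eq_sym -ju.
  by apply: contraNneq (recolu g) => ->; apply: (Fmem (j, false)).
have [jv|jv] := eqVneq (w (j, true)) u.
  rewrite jv (recolE g (w (j, false))) //; apply/orP; right.
  by apply: contraNneq (recolu g) => <-; apply: (Fmem (j, true)).
rewrite !recolE //.
move: gS; rewrite !inE => /andP[_ /forall_inP]; apply; rewrite in_setD1 jK andbT.
by apply: contraNneq ju => ->.
Qed.

Lemma loose_colorings_gt0 K w r :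
  (forall x, content w x <= r)%N -> (r < q)%N -> (0 < loose_colorings K w)%N.
Proof.
move=> wr rq; move: {2}#|K| (erefl #|K|) => c; elim: c K => [|c IH] K Kc.
  rewrite (cards0_eq Kc); apply/card_gt0P.
  exists [ffun=> Ordinal (leq_ltn_trans (leq0n r) rq)].
  by rewrite inE; apply/forall_inP => k; rewrite inE.
have [k kK] : exists k, k \in K by apply/card_gt0P; rewrite Kc.
have := IH (K :\ k); rewrite (cardsD1 k) kK in Kc; case: Kc => Kc /(_ Kc) h.
by have := leq_trans h (loose_colorings_remove K k wr rq); rewrite muln_gt0 => /andP[].
Qed.

Lemma eq_loose_colorings K w w' :
  (forall k b, k \in K -> w (k, b) = w' (k, b)) ->
  loose_colorings K w = loose_colorings K w'.
Proof.
move=> h; apply: eq_card => g; rewrite !inE.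
by apply/forall_inP/forall_inP => H k kK; have := H k kK; rewrite !h.
Qed.

(** Only the pairs [k] and [l] that contain the exchanged half-edges are affected:
    delete both, then add them back. *)
Lemma loose_colorings_swap (nu : {ffun P -> 'I_n}) (r : nat) (s : {perm P}) x y :
  (forall x, content nu x <= r)%N -> (r < q)%N ->
  (loose_colorings [set: 'I_m]%SET (shuffle nu (s * tperm x y)%g)
    <= 4 * loose_colorings [set: 'I_m]%SET (shuffle nu s))%N.
Proof.
move=> nur rq; set w := shuffle nu s; set w' := shuffle nu _.
have wr z : (content w z <= r)%N by rewrite content_shuffle.
set k := ((s^-1)%g x).1; set l := ((s^-1)%g y).1.
have E : loose_colorings ([set: 'I_m]%SET :\ k :\ l) w = loose_colorings ([set: 'I_m]%SET :\ k :\ l) w'.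
  apply: eq_loose_colorings => j b; rewrite !inE andbT => /andP[jl jk].
  rewrite !ffunE permM tpermD //.
    by apply: contraNneq jk => xE; rewrite /k xE permK.
  by apply: contraNneq jl => yE; rewrite /l yE permK.
have h1 := loose_colorings_remove [set: 'I_m]%SET k wr rq.
have h2 := loose_colorings_remove ([set: 'I_m]%SET :\ k) l wr rq.
have h3 : (loose_colorings [set: 'I_m]%SET w' <= loose_colorings ([set: 'I_m]%SET :\ k :\ l) w')%N.
  by apply: loose_colorings_mono; apply: finset.subsetT.
rewrite -E in h3; apply: leq_trans h3 (leq_trans h2 _).
by rewrite (_ : 4 = 2 * 2)%N // -mulnA leq_mul2l h1 orbT.
Qed.

Lemma ln_loose_colorings_lip (R : realType) (nu : {ffun P -> 'I_n}) (r : nat)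
    (s : {perm P}) x y :
  (forall x, content nu x <= r)%N -> (r < q)%N ->
  `|ln (loose_colorings [set: 'I_m]%SET (shuffle nu (s * tperm x y)%g))%:R
    - ln (loose_colorings [set: 'I_m]%SET (shuffle nu s))%:R| <= ln 4 :> R.
Proof.
move=> nur rq.
have pos t : (0 < loose_colorings [set: 'I_m]%SET (shuffle nu t))%N.
  by apply: (@loose_colorings_gt0 _ _ r) => // z; rewrite content_shuffle.
have lnle (a b : nat) : (0 < a)%N -> (0 < b)%N -> (a <= 4 * b)%N -> ln a%:R <= ln 4 + ln b%:R :> R.
  move=> a0 b0 ab; rewrite -lnM ?posrE ?ltr0n // ler_ln ?posrE ?mulr_gt0 ?ltr0n //.
  by rewrite -natrM ler_nat.
have h1 := lnle _ _ (pos _) (pos _) (loose_colorings_swap s x y nur rq).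
have h2 := loose_colorings_swap (s * tperm x y)%g x y nur rq.
rewrite -mulgA tperm2 mulg1 in h2.
have {}h2 := lnle _ _ (pos _) (pos _) h2.
by rewrite ler_norml; lra.
Qed.
End Lipschitz.

(** * Random pairings are simple with polynomial probability *)

Section Simple.
Variables (n m : nat).
Notation P := (half_edges m).
Implicit Types (w : {ffun P -> 'I_n}).

Definition mate (p : P) : P := (p.1, ~~ p.2).

Lemma mateK : involutive mate.
Proof. by case=> k b; rewrite /mate negbK. Qed.

Lemma mate_neq p : mate p != p.
Proof. by case: p => k b; rewrite /mate -pair_eqE /pair_eq /= eqxx; case: b. Qed.

Definition pair_edge w (k : 'I_m) : {set 'I_n} := [set w (k, false); w (k, true)]%SET.

Definition is_loop w k : bool := w (k, false) == w (k, true).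

Definition bad w l : bool :=
  is_loop w l || [exists k, (k != l) && (pair_edge w k == pair_edge w l)].

Definition bads w : {set 'I_m} := [set l | bad w l]%SET.

Definition adjacent w x z : bool := [exists p, (w p == x) && (w (mate p) == z)].

Lemma pair_edgeE w p : pair_edge w p.1 = [set w p; w (mate p)]%SET.
Proof. by case: p => k [] //; rewrite /pair_edge /mate /= finset.setUC. Qed.

Lemma adjacent_pair_edge w k x z :
  x != z -> pair_edge w k = [set x; z]%SET -> adjacent w x z.
Proof.
move=> xz e.
have : x \in pair_edge w k by rewrite e !inE eqxx.
have : z \in pair_edge w k by rewrite e !inE eqxx orbT.
rewrite !inE => /orP[]/eqP zE /orP[]/eqP xE.
- by rewrite xE zE eqxx in xz.
- by apply/existsP; exists (k, true); rewrite /mate /= -xE -zE !eqxx.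
- by apply/existsP; exists (k, false); rewrite /mate /= -xE -zE !eqxx.
- by rewrite xE zE eqxx in xz.
Qed.

Lemma card_fibre_preimage w (r : nat) (Z : {set 'I_n}) :
  (forall x, content w x <= r)%N -> (#|[set p | w p \in Z]%SET| <= #|Z| * r)%N.
Proof.
move=> wr; rewrite -sum1dep_card (partition_big w (fun x => x \in Z)) //=.
rewrite -sum_nat_const; apply: leq_sum => x xZ.
apply: leq_trans (wr x); rewrite ffunE -sum1dep_card.
rewrite (eq_bigl (fun p => w p == x)) // => p.
by rewrite andbC; case: eqP => // ->; rewrite xZ.
Qed.

Definition neighbours w x : {set 'I_n} := [set w (mate p) | p in [set p | w p == x]%SET]%SET.

Lemma card_neighbours w r x : (forall x, content w x <= r)%N -> (#|neighbours w x| <= r)%N.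
Proof.
by move=> wr; apply: leq_trans (leq_imset_card _ _) _; have := wr x; rewrite ffunE.
Qed.

Lemma adjacent_neighbours w x z : adjacent w x z -> z \in neighbours w x.
Proof.
by move=> /existsP[p /andP[wp /eqP wm]]; apply/imsetP; exists p; rewrite ?inE.
Qed.

Definition bads_bound (r : nat) : nat := (r + (r + (2 + r * r)))%N.

Lemma card_loop_after_swap w r l : (forall x, content w x <= r)%N ->
  (#|[set p : P | is_loop (shuffle w (tperm (l, true) p)) l]%SET| <= r)%N.
Proof.
move=> wr; apply: leq_trans (wr (w (l, false))); rewrite ffunE.
apply: subset_leq_card; apply/fintype.subsetP => p; rewrite !inE /is_loop !ffunE tpermL.
have [->|pl] := eqVneq p (l, false); first by rewrite eqxx.
by rewrite tpermD ?(mate_neq (l, false)) // eq_sym.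
Qed.

(** If the pair [l] is bad after the exchange of [(l, true)] and [p], then it
    is now a loop, or [p] belongs to [l], or [p] lies at a node that was already
    adjacent to the first end of [l]. *)
Lemma card_bad_after_swap w r l : (forall x, content w x <= r)%N -> ~~ is_loop w l ->
  (#|[set p : P | bad (shuffle w (tperm (l, true) p)) l]%SET| <= r + (2 + r * r))%N.
Proof.
move=> wr nl; set x := w (l, false).
pose L := [set p : P | is_loop (shuffle w (tperm (l, true) p)) l]%SET.
pose B := [set p : P | w p \in neighbours w x]%SET.
pose E := [set (l, false); (l, true)]%SET : {set P}.
have sub : [set p : P | bad (shuffle w (tperm (l, true) p)) l]%SET \subset L :|: (E :|: B).
  apply/fintype.subsetP => p; rewrite !inE -orbA => /orP[->//|/existsP[k /andP[kl /eqP e]]].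
  set w' := shuffle w _ in e *; case nl' : (is_loop w' l) => //=.
  have [->|p0] := eqVneq p (l, false); first by rewrite ?orbT.
  have [->|p1] := eqVneq p (l, true); first by rewrite ?orbT.
  rewrite /=; have w'lf : w' (l, false) = x by rewrite ffunE tpermD // (mate_neq (l, false)).
  have w'lt : w' (l, true) = w p by rewrite ffunE tpermL.
  have xwp : x != w p by move: nl'; rewrite /is_loop w'lf w'lt => ->.
  move: e; rewrite {2}/pair_edge w'lf w'lt => e.
  apply: adjacent_neighbours.
  have [kp|kp] := eqVneq k p.1; last first.
    apply: (@adjacent_pair_edge _ k) => //; rewrite -e /pair_edge.
    have same b : w' (k, b) = w (k, b).
      rewrite ffunE tpermD //; first by apply: contraNneq kl => -[->].
      by apply: contraNneq kp => ->.
    by rewrite !same.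
  have pl : p.1 != l by rewrite -kp.
  have xin : x \in pair_edge w' p.1 by rewrite -kp e !inE eqxx.
  rewrite pair_edgeE !inE in xin.
  have wp' : w' p = w (l, true) by rewrite ffunE tpermR.
  have wm' : w' (mate p) = w (mate p).
    rewrite ffunE tpermD //; last by rewrite eq_sym mate_neq.
    by apply: contraNneq pl => pE; rewrite -[p.1]/((mate p).1) -pE.
  move: xin; rewrite wp' wm' => /orP[/eqP xE|/eqP xE].
    by move: nl; rewrite /is_loop -/x xE eqxx.
  by apply/existsP; exists (mate p); rewrite mateK -xE !eqxx.
apply: leq_trans (subset_leq_card sub) _.
apply: leq_trans (leq_card_setU _ _) _; apply: leq_add; first exact: card_loop_after_swap.
apply: leq_trans (leq_card_setU _ _) _; apply: leq_add; first by rewrite cards2; case: eqP.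
apply: leq_trans (card_fibre_preimage _ wr) _; rewrite leq_mul2r; apply/orP; right.
exact: card_neighbours.
Qed.

(** Exchanging the contents of two fixed positions preserves the uniform measure,
    so probabilities may be averaged over the position [p]. *)
Lemma swap_average (nu : {ffun P -> 'I_n}) (E : pred {ffun P -> 'I_n}) (a : P) :
  (#|{: P}| * #|[set s | E (shuffle nu s)]%SET| =
   \sum_(s : {perm P}) #|[set p | E (shuffle (shuffle nu s) (tperm a p))]%SET|)%N.
Proof.
rewrite -[#|{: P}|]sum1_card big_distrl /=.
under [RHS]eq_bigr do rewrite -sum1dep_card big_mkcond /=.
rewrite exchange_big /=; apply: eq_bigr => p _; rewrite mul1n.
rewrite -sum1dep_card big_mkcond /= (reindex_inj (mulgI (tperm a p))) /=.
by apply: eq_bigr => s _; rewrite shuffleM.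
Qed.

(** By [swap_average], applied to loops first and then to repeated pairs, each of
    the [N / 2] pairs is bad with probability of order [1 / N]; so the expected
    number of bad pairs is bounded independently of [n]. *)
Lemma sum_bads (nu : {ffun P -> 'I_n}) (r : nat) : (0 < m)%N ->
  (forall x, content nu x <= r)%N ->
  (2 * \sum_(s : {perm P}) #|bads (shuffle nu s)| <= bads_bound r * (#|{: P}|)`!)%N.
Proof.
move=> m0 nur.
have wr s x : (content (shuffle nu s) x <= r)%N by rewrite content_shuffle.
have PE : #|{: P}| = (m * 2)%N by rewrite card_prod card_ord card_bool.
have loops l : (#|{: P}| * #|[set s : {perm P} | is_loop (shuffle nu s) l]%SET| <= r * (#|{: P}|)`!)%N.
  rewrite (swap_average nu (fun w => is_loop w l) (l, true)) -card_perms mulnC -sum_nat_const.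
  by apply: leq_sum => s _; apply: card_loop_after_swap.
have badl l : (#|{: P}| * #|[set s : {perm P} | bad (shuffle nu s) l]%SET| <=
    bads_bound r * (#|{: P}|)`!)%N.
  rewrite /bads_bound (swap_average nu (fun w => bad w l) (l, true)) mulnDl.
  apply: (@leq_trans (\sum_(s : {perm P}) (#|{: P}| * is_loop (shuffle nu s) l + (r + (2 + r * r))))).
    apply: leq_sum => s _; case: (boolP (is_loop (shuffle nu s) l)) => [_|nl].
      by rewrite muln1; apply: leq_trans (leq_addr _ _); apply: max_card.
    by rewrite muln0 add0n; apply: card_bad_after_swap.
  rewrite big_split /=; apply: leq_add.
    apply: leq_trans (loops l); rewrite -big_distrr leq_mul2l; apply/orP; right.
    rewrite -sum1dep_card [leqRHS]big_mkcond /=; apply: leq_sum => s _; by case: ifP.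
  by rewrite sum_nat_const -card_perms mulnC.
rewrite -(leq_pmul2l m0) mulnA -PE.
rewrite (_ : \sum_s _ = \sum_l #|[set s : {perm P} | bad (shuffle nu s) l]%SET|)%N; last first.
  under eq_bigr do rewrite -sum1dep_card big_mkcond /=.
  rewrite exchange_big /=; apply: eq_bigr => l _.
  by rewrite -sum1dep_card [RHS]big_mkcond.
rewrite big_distrr /= -[X in (_ <= X * _)%N](card_ord m) -sum_nat_const.
by apply: leq_sum => l _; apply: badl.
Qed.

(** Switching: exchange one end of a bad pair [l] with one end of a good pair [j]
    that is far from [l].  Neither new pair repeats an old one, so [l] becomes
    good and no pair becomes bad. *)
Lemma exists_good_swap w r K : (forall x, content w x <= r)%N ->
  (0 < #|bads w| <= K)%N -> (K + (2 + r + r) * r < m)%N ->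
  exists p p', (#|bads (shuffle w (tperm p p'))| < #|bads w|)%N.
Proof.
move=> wr /andP[b0 bK] mK.
have [l lb] : exists l, l \in bads w by apply/card_gt0P.
set u := w (l, false); set v := w (l, true).
pose Z := [set u; v]%SET :|: neighbours w u :|: neighbours w v.
have cZ : (#|Z| <= 2 + r + r)%N.
  apply: leq_trans (leq_card_setU _ _) _; apply: leq_add; last exact: card_neighbours.
  apply: leq_trans (leq_card_setU _ _) _; apply: leq_add; last exact: card_neighbours.
  by rewrite cards2; case: eqP.
pose X := bads w :|: [set p.1 | p in [set p | w p \in Z]%SET]%SET.
have cX : (#|X| < m)%N.
  apply: leq_ltn_trans mK; apply: leq_trans (leq_card_setU _ _) _; apply: leq_add => //.
  apply: leq_trans (leq_imset_card _ _) _; apply: leq_trans (card_fibre_preimage _ wr) _.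
  by rewrite leq_mul2r cZ orbT.
have [j jX] : exists j, j \notin X.
  apply/existsP; rewrite -negb_forall; apply/negP => /forallP h.
  move: cX; rewrite ltnNge -{1}(card_ord m) => /negP[]; apply: subset_leq_card.
  by apply/fintype.subsetP => j _; apply: h.
move: jX; rewrite inE negb_or => /andP[jb jZ].
have jw b : w (j, b) \notin Z.
  by apply: contra jZ => h; apply/imsetP; exists (j, b) => //; rewrite inE.
set x := w (j, false); set y := w (j, true).
have [xu yv yu] : [/\ x != u, y != v & y != u].
  have := jw false; have := jw true; rewrite !inE !negb_or -!andbA.
  by move=> /and4P[-> -> _ _] /and4P[-> _ _ _].
have xv : x != v.
  by have := jw false; rewrite !inE !negb_or -!andbA => /and4P[].
have nux : ~~ adjacent w u x.
  by apply: contra (jw false) => /adjacent_neighbours h; rewrite !finset.in_setU h orbT.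
have nvy : ~~ adjacent w v y.
  by apply: contra (jw true) => /adjacent_neighbours h; rewrite !finset.in_setU h orbT.
have lj : l != j by apply: contraNneq jb => <-.
exists (l, true), (j, false); set w' := shuffle w _.
have w'lf : w' (l, false) = u by rewrite ffunE tpermD // -pair_eqE /pair_eq /= ?andbF // eq_sym (negPf lj).
have w'lt : w' (l, true) = x by rewrite ffunE tpermL.
have w'jf : w' (j, false) = v by rewrite ffunE tpermR.
have w'jt : w' (j, true) = y by rewrite ffunE tpermD // -pair_eqE /pair_eq /= ?andbF // (negPf lj).
have w'k k b : k != l -> k != j -> w' (k, b) = w (k, b).
  by move=> kl kj; rewrite ffunE tpermD // -pair_eqE /pair_eq /= eq_sym ?(negPf kl) ?(negPf kj).
have el : pair_edge w' l = [set u; x]%SET by rewrite /pair_edge w'lf w'lt.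
have ej : pair_edge w' j = [set v; y]%SET by rewrite /pair_edge w'jf w'jt.
have ek k : k != l -> k != j -> pair_edge w' k = pair_edge w k.
  by move=> kl kj; rewrite /pair_edge !w'k.
have ux : u != x by rewrite eq_sym.
have vy : v != y by rewrite eq_sym.
have xy : x != y by move: jb; rewrite inE negb_or => /andP[].
have elj : pair_edge w' l != pair_edge w' j.
  rewrite el ej; apply/eqP => e.
  have : x \in [set v; y]%SET by rewrite -e !inE eqxx orbT.
  by rewrite !inE (negPf xv) (negPf xy).
have elk k : k != l -> pair_edge w' k != pair_edge w' l.
  move=> kl; have [->|kj] := eqVneq k j; first by rewrite eq_sym.
  rewrite el ek //; apply: contra nux => /eqP; exact: adjacent_pair_edge.
have ejk k : k != j -> pair_edge w' k != pair_edge w' j.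
  move=> kj; have [->//|kl] := eqVneq k l.
  rewrite ej ek //; apply: contra nvy => /eqP; exact: adjacent_pair_edge.
have sub : bads w' \subset bads w :\ l.
  apply/fintype.subsetP => k; rewrite in_setD1 !inE => kbad.
  have kl : k != l.
    apply/eqP => kl; move: kbad; rewrite kl /bad /is_loop w'lf w'lt (negPf ux) /=.
    by move=> /existsP[k' /andP[/elk/negPf ->]].
  have kj : k != j.
    apply/eqP => kj; move: kbad; rewrite kj /bad /is_loop w'jf w'jt (negPf vy) /=.
    by move=> /existsP[k' /andP[/ejk/negPf ->]].
  rewrite kl /=; move: kbad; rewrite /bad /is_loop !w'k // => /orP[->//|/existsP[k' /andP[k'k e]]].
  apply/orP; right; apply/existsP; exists k'; rewrite k'k /=.
  have k'l : k' != l.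
    by apply/eqP => k'l; move: (elk k kl); rewrite -k'l eq_sym e.
  have k'j : k' != j.
    by apply/eqP => k'j; move: (ejk k kj); rewrite -k'j eq_sym e.
  by move: e; rewrite !ek.
by apply: leq_ltn_trans (subset_leq_card sub) _; rewrite (cardsD1 l (bads w)) lb.
Qed.

Definition simple_word w : bool := [forall l, ~~ bad w l].

Lemma simple_wordE w : simple_word w = (#|bads w| == 0%N).
Proof.
rewrite cards_eq0; apply/forallP/eqP => [h|h l].
  by apply/setP => l; rewrite !inE; apply/negbTE.
by have /setP/(_ l) := h; rewrite !inE => ->.
Qed.

(** By [sum_bads] and Markov's inequality, at least half of the shuffles have at
    most [bads_bound r] bad pairs, and each of these becomes simple after at most
    that many transpositions.  Every shuffle is reached from at most [N ^ 2]
    others in one such step. *)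
Lemma card_simple_ge (nu : {ffun P -> 'I_n}) (r : nat) :
  (forall x, content nu x <= r)%N -> (bads_bound r + (2 + r + r) * r < m)%N ->
  ((#|{: P}|)`! <=
     2 * ((#|{: P}| ^ 2) ^ bads_bound r * #|[set s | simple_word (shuffle nu s)]%SET|))%N.
Proof.
set K := bads_bound r; move=> nur mK.
have m0 : (0 < m)%N by apply: leq_ltn_trans mK.
have wr s x : (content (shuffle nu s) x <= r)%N by rewrite content_shuffle.
pose A j := [set s : {perm P} | (#|bads (shuffle nu s)| <= j)%N]%SET.
have step j : (j < K)%N -> (#|A j.+1| <= #|{: P}| ^ 2 * #|A j|)%N.
  move=> jK.
  have sub : A j.+1 \subset
     [set (tperm u.1 u.2 * s)%g | u in [set: P * P]%SET, s in A j]%SET.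
    apply/fintype.subsetP => s; rewrite inE => sj.
    have [le|gt] := leqP #|bads (shuffle nu s)| j.
      apply/imset2P; exists ((Ordinal m0, true), (Ordinal m0, true)) s; rewrite ?inE //=.
      by rewrite tperm1 mul1g.
    have bd : (0 < #|bads (shuffle nu s)| <= K)%N.
      by rewrite (leq_ltn_trans _ gt) //= (leq_trans sj).
    have [p [p' lt]] := exists_good_swap (wr s) bd mK.
    apply/imset2P; exists (p, p') (tperm p p' * s)%g; rewrite ?inE //=.
      by rewrite -shuffleM -ltnS (leq_trans lt).
    by rewrite mulgA tperm2 mul1g.
  apply: leq_trans (subset_leq_card sub) _; rewrite curry_imset2X.
  by apply: leq_trans (leq_imset_card _ _) _; rewrite cardsX cardsT card_prod mulnn.
have AK j : (j <= K)%N -> (#|A j| <= (#|{: P}| ^ 2) ^ j * #|A 0|)%N.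
  elim: j => [|j IH] jK; first by rewrite mul1n.
  by apply: leq_trans (step _ jK) _; rewrite [((#|{: P}| ^ 2) ^ j.+1)%N]expnS -mulnA leq_mul2l IH ?orbT // ltnW.
have A0 : A 0%N = [set s | simple_word (shuffle nu s)]%SET.
  by apply/setP => s; rewrite !inE simple_wordE leqn0.
rewrite -A0; apply: leq_trans (leq_mul (leqnn 2) (AK K (leqnn K))).
have markov : (K.+1 * #|~: A K| <= \sum_(s : {perm P}) #|bads (shuffle nu s)|)%N.
  rewrite mulnC -sum_nat_const big_mkcond /=; apply: leq_sum => s _.
  by rewrite !inE -ltnNge; case: ifP.
have := sum_bads m0 nur; rewrite -/K => sb.
have := cardsC (A K); rewrite card_perms => <-.
have : (2 * #|~: A K| <= (#|{: P}|)`!)%N.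
  rewrite -(leq_pmul2l (isT : 0 < K.+1)%N) mulnCA.
  apply: leq_trans (leq_mul (leqnn 2) markov) _; apply: leq_trans sb _.
  by rewrite leq_mul2r leqnSn orbT.
by rewrite -card_perms -(cardsC (A K)); lia.
Qed.
End Simple.

(** * From pairings to regular graphs *)

Section GraphOfWord.
Variables (n m : nat).
Notation P := (half_edges m).
Implicit Types (w : {ffun P -> 'I_n}) (G : {set {set 'I_n}}).

Definition graph_of w : {set {set 'I_n}} := [set pair_edge w k | k : 'I_m]%SET.

Lemma simple_wordP w :
  reflect ((forall k, ~~ is_loop w k) /\ injective (pair_edge w)) (simple_word w).
Proof.
apply: (iffP forallP) => [h|[h1 h2] l].
  split=> [k|k l e]; first by have := h k; rewrite negb_or => /andP[].
  have := h l; rewrite negb_or => /andP[_ /existsPn/(_ k)].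
  by rewrite e eqxx andbT negbK => /eqP.
rewrite negb_or h1; apply/existsPn => k; rewrite negb_and negbK.
by case: (k =P l) => //= kl; apply/eqP => /h2.
Qed.

Lemma degree_graph_of w x : simple_word w -> degree (graph_of w) x = content w x.
Proof.
move=> /simple_wordP[nl inj].
have -> : degree (graph_of w) x = #|[set k | x \in pair_edge w k]%SET|.
  rewrite -(card_imset _ inj); apply: eq_card => e; rewrite inE.
  apply/andP/imsetP => [[/imsetP[k _ ->] xk]|[k + ->]].
    by exists k; rewrite ?inE // in xk *.
  by rewrite inE => xk; split=> //; apply: imset_f.
rewrite contentE -sum1dep_card big_mkcond /=.
transitivity (\sum_k \sum_(b : bool) (w (k, b) == x))%N; last first.
  by rewrite pair_bigA; apply: eq_bigr => -[].
apply: eq_bigr => k _; rewrite big_bool /= !inE ![x == _]eq_sym.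
have := nl k; rewrite /is_loop.
by case: (w (k, false) =P x) => [->|_]; case: (w (k, true) =P x) => [->|_]; rewrite ?eqxx.
Qed.

Lemma graph_of_regular w r : simple_word w -> (forall x, content w x = r) ->
  graph_of w \in regular_graphs r n.
Proof.
move=> sw wr; rewrite inE; apply/andP; split; last first.
  by apply/forallP => x; rewrite degree_graph_of // wr.
apply/forall_inP => e /imsetP[k _ ->]; rewrite cards2.
by have /simple_wordP[/(_ k)] := sw; rewrite /is_loop => ->.
Qed.

Lemma proper_graph_of q w (f : {ffun 'I_n -> 'I_q}) :
  proper_coloring (graph_of w) f = proper_on w f.
Proof.
apply/forallP/forallP => [h k|h x].
  have /forallP/(_ (w (k, true)))/implyP := h (w (k, false)); apply.
  by apply/imsetP; exists k.
apply/forallP => y; apply/implyP => /imsetP[k _ e].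
have hk := h k; have nl : w (k, false) != w (k, true) by apply: contra hk => /eqP ->.
have : w (k, false) \in [set x; y]%SET by rewrite e !inE eqxx.
have : w (k, true) \in [set x; y]%SET by rewrite e !inE eqxx orbT.
rewrite !inE => /orP[]/eqP e1 /orP[]/eqP e0.
- by move: nl; rewrite e1 e0 eqxx.
- by move: hk; rewrite e1 e0 eq_sym.
- by move: hk; rewrite e1 e0.
- by move: nl; rewrite e1 e0 eqxx.
Qed.

Lemma num_colorings_graph_of q w : num_colorings q (graph_of w) = word_colorings q w.
Proof. by apply: eq_card => f; rewrite !inE proper_graph_of. Qed.

Lemma num_colorings_loose q w : simple_word w ->
  num_colorings q (graph_of w) = loose_colorings q [set: 'I_m]%SET w.
Proof.
move=> /simple_wordP[nl _]; rewrite num_colorings_graph_of; apply: eq_card => f.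
rewrite !inE; apply/forallP/forall_inP => h k => [_|]; first by rewrite h orbT.
by have := h k (finset.in_setT _); have := nl k; rewrite /is_loop => /negPf ->.
Qed.

Lemma word_le_loose q w : (word_colorings q w <= loose_colorings q [set: 'I_m]%SET w)%N.
Proof.
apply: subset_leq_card; apply/fintype.subsetP => f; rewrite !inE => /forallP h.
by apply/forall_inP => k _; rewrite h orbT.
Qed.

Lemma card_ends (T : finType) (E : {set T}) : #|E| = 2%N ->
  #|[set v : T * T | [set v.1; v.2]%SET == E]%SET| = 2%N.
Proof.
move=> /eqP/cards2P[a [b [ab ->]]].
have -> : [set v : T * T | [set v.1; v.2]%SET == [set a; b]%SET]%SET = [set (a, b); (b, a)]%SET.
  apply/setP => -[x y]; rewrite !inE /=; apply/eqP/idP => [e|].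
    have xin : x \in [set a; b]%SET by rewrite -e !inE eqxx.
    have yin : y \in [set a; b]%SET by rewrite -e !inE eqxx orbT.
    have ain : a \in [set x; y]%SET by rewrite e !inE eqxx.
    have bin : b \in [set x; y]%SET by rewrite e !inE eqxx orbT.
    move: xin yin ain bin; rewrite !inE -!pair_eqE /pair_eq /=.
    move=> /orP[]/eqP-> /orP[]/eqP->; rewrite ?eqxx ?orbT //= ?orbF.
      by rewrite [b == a]eq_sym (negPf ab).
    by rewrite (negPf ab).
  by move=> /orP[]/eqP[-> ->] //; rewrite finset.setUC.
by rewrite cards2 -pair_eqE /pair_eq /= (negPf ab).
Qed.

Lemma card_words_of_edges (e : {ffun 'I_m -> {set 'I_n}}) :
  (forall k, #|e k| = 2%N) ->
  #|[set w : {ffun P -> 'I_n} | [forall k, pair_edge w k == e k]]%SET| = (2 ^ m)%N.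
Proof.
move=> e2; rewrite -sum1dep_card (reindex (@of_pairs m 'I_n)) /=; last first.
  exact: onW_bij (of_pairs_bij m 'I_n).
pose g k (v : 'I_n * 'I_n) : nat := [set v.1; v.2]%SET == e k.
transitivity (\sum_(u : {ffun 'I_m -> 'I_n * 'I_n}) \prod_k g k (u k))%N.
  rewrite big_mkcond /=; apply: eq_bigr => u _.
  have pe k : pair_edge (of_pairs u) k = [set (u k).1; (u k).2]%SET by rewrite /pair_edge !ffunE.
  case: forallP => [h|/forallP].
    by rewrite big1 // => k _; have := h k; rewrite pe /g => ->.
  by rewrite negb_forall => /existsP[k]; rewrite pe (bigD1 k) //= /g => /negPf ->.
rewrite -(bigA_distr_bigA g) /= -[m in RHS]card_ord -prod_nat_const.
apply: eq_bigr => k _; rewrite -(card_ends (e2 k)) -sum1dep_card [RHS]big_mkcond /=.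
by apply: eq_bigr => v _; rewrite /g; case: ifP.
Qed.

Lemma card_regular_graph G r : (r * n = m * 2)%N -> G \in regular_graphs r n -> #|G| = m.
Proof.
move=> rn; rewrite inE => /andP[/forall_inP G2 /forallP deg].
suff E : (#|G| * 2 = n * r)%N.
  by apply/eqP; rewrite -(eqn_pmul2r (isT : 0 < 2)%N) E mulnC rn.
rewrite -[X in _ = (X * _)%N]card_ord -!sum_nat_const.
rewrite (eq_bigr (fun e : {set 'I_n} => #|e|)) => [|e /G2/eqP -> //].
rewrite [RHS](eq_bigr (fun x => degree G x)) => [|x _]; last by have /eqP := deg x.
under eq_bigr do rewrite -sum1_card big_mkcond /=.
rewrite exchange_big /=; apply: eq_bigr => x _.
by rewrite /degree -sum1dep_card big_mkcondr.
Qed.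

(** Such a word lists the [m] edges of [G] in some order, each of them in one of
    its two directions. *)
Lemma card_words_of_graph G r : (r * n = m * 2)%N -> G \in regular_graphs r n ->
  #|[set w : {ffun P -> 'I_n} | [&& [forall x, content w x == r], simple_word w & graph_of w == G]]%SET|
   = (m`! * 2 ^ m)%N.
Proof.
move=> rn Greg; have cG := card_regular_graph rn Greg.
have := Greg; rewrite inE => /andP[/forall_inP G2 /forallP deg].
pose ew w : {ffun 'I_m -> {set 'I_n}} := [ffun k => pair_edge w k].
pose Inj := [set e : {ffun 'I_m -> {set 'I_n}} in ffun_on (mem G) | injectiveb e]%SET.
have cInj : #|Inj| = m`! by rewrite card_inj_ffuns_on card_ord cG ffactnn.
rewrite -cInj -sum_nat_const -sum1dep_card.
rewrite (partition_big ew (fun e => e \in Inj)) /=; last first.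
  move=> w /and3P[_ /simple_wordP[_ inj] /eqP wG]; rewrite inE; apply/andP; split.
    by apply/ffun_onP => k; rewrite ffunE -wG; apply: imset_f.
  by apply/injectiveP => k l; rewrite !ffunE => /inj.
apply: eq_bigr => e; rewrite inE => /andP[/ffun_onP eG /injectiveP einj].
rewrite -(@card_words_of_edges e) => [|k]; last by have /eqP := G2 _ (eG k).
rewrite -sum1dep_card; apply: eq_bigl => w.
apply/andP/forallP => [[_ /eqP <-] k|h]; first by rewrite ffunE.
have he k : pair_edge w k = e k by apply/eqP.
have sw : simple_word w.
  apply/simple_wordP; split=> [k|k l]; last by rewrite !he => /einj.
  have := G2 _ (eG k); rewrite -he cards2 /is_loop; by case: (w (k, false) == w (k, true)).
have wG : graph_of w = G.
  apply/eqP; rewrite eqEcard cG card_imset ?cardT ?size_enum_ord ?leqnn ?andbT.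
    by apply/fintype.subsetP => _ /imsetP[k _ ->]; rewrite he; apply: eG.
  by case/simple_wordP: sw.
split; last by apply/eqP/ffunP => k; rewrite ffunE he.
rewrite sw wG eqxx !andbT; apply/forallP => x.
by rewrite -degree_graph_of // wG.
Qed.

Lemma exists_pairing_map r : (r * n = m * 2)%N -> 
  exists nu : {ffun P -> 'I_n}, forall x, content nu x = r.
Proof.
move=> rn; pose k : {ffun 'I_n -> nat} := [ffun => r].
have kS : (\sum_i k i)%N = #|{: P}|.
  rewrite card_prod card_ord card_bool -rn mulnC -[n in RHS]card_ord -sum_nat_const.
  by apply: eq_bigr => i _; rewrite ffunE.
have : (0 < #|words P k|)%N.
  rewrite lt0n; apply/eqP => W0.
  have := @card_words_ge P 'I_n rat k kS; rewrite W0 mul0r mulr0.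
  have [->|P0] := posnP #|{: P}|; first by rewrite expr0 ler10.
  by rewrite leNgt exprn_gt0 // ltr0n.
move=> /card_gt0P[nu]; rewrite in_words => /eqP nuk.
by exists nu => x; rewrite nuk ffunE.
Qed.

(** Every regular graph comes from the same number of words
    ([card_words_of_graph]), and every word from the same number of shuffles. *)
Lemma prob_regular_shuffle (R : realType) (r : nat) (nu : {ffun P -> 'I_n})
    (A : pred {set {set 'I_n}}) : (r * n = m * 2)%N -> (forall x, content nu x = r) ->
  prob_regular R r A =
   #|[set s : {perm P} | simple_word (shuffle nu s) && A (graph_of (shuffle nu s))]%SET|%:R
   / #|[set s : {perm P} | simple_word (shuffle nu s)]%SET|%:R.
Proof.
move=> rn nur.
pose M := #|words P (content nu)|.
have M0 : (0 < M)%N by apply/card_gt0P; exists nu; rewrite in_words.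
pose F := (m`! * 2 ^ m)%N.
have F0 : (0 < F)%N by rewrite muln_gt0 fact_gt0 expn_gt0.
have key (B : pred {set {set 'I_n}}) :
   (#|[set s : {perm P} | simple_word (shuffle nu s) && B (graph_of (shuffle nu s))]%SET| * M
    = (#|{: P}|)`! * (F * #|[set G in regular_graphs r n | B G]%SET|))%N.
  rewrite (card_shuffle_in nu (fun w => simple_word w && B (graph_of w))); congr (_ * _)%N.
  rewrite [RHS]mulnC -sum_nat_const -sum1dep_card.
  rewrite (partition_big graph_of (fun G => G \in [set G in regular_graphs r n | B G]%SET)) /=.
    apply: eq_bigr => G; rewrite inE => /andP[Greg BG].
    rewrite /F -(card_words_of_graph rn Greg) -sum1dep_card; apply: eq_bigl => w.
    rewrite in_words; case: (graph_of w =P G) => [->|_]; rewrite ?andbF // BG !andbT.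
    congr (_ && _); apply/eqP/forallP => [-> x|h]; first by rewrite nur.
    by apply/ffunP => x; rewrite nur; apply/eqP.
  move=> w /andP[]; rewrite in_words => /eqP wc /andP[sw Bw].
  by rewrite inE Bw andbT graph_of_regular // => x; rewrite wc.
clearbody F.
have k1 := key A; have k2 := key xpredT.
set a := #|_| in k1 *; set b := #|[set s | simple_word _]%SET|.
have b2 : (b * M = (#|{: P}|)`! * (F * #|regular_graphs r n|))%N.
  rewrite (_ : b = #|[set s : {perm P} | simple_word (shuffle nu s) && true]%SET|).
    by rewrite k2; congr (_ * (_ * _))%N; apply: eq_card => G; rewrite !inE andbT.
  by apply: eq_card => s; rewrite !inE andbT.
rewrite /prob_regular.
set c := #|[set G in _ | A G]%SET| in k1 *.
have unitM : M%:R != 0 :> R by rewrite pnatr_eq0 -lt0n.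
have unitF : ((#|{: P}|)`! * F)%:R != 0 :> R by rewrite pnatr_eq0 -lt0n muln_gt0 fact_gt0.
rewrite -(mulfK unitM a%:R) -(mulfK unitM b%:R) -!natrM k1 b2 !mulnA.
rewrite (natrM _ (_ * F) c) (natrM _ (_ * F) #|regular_graphs r n|).
have [->|b0] := eqVneq (#|regular_graphs r n|%:R : R) 0.
  by rewrite mulr0 mul0r invr0 !mulr0.
set x := (_ * F)%:R in unitF *; set y := #|regular_graphs r n|%:R in b0 *.
by clearbody x y; field; rewrite unitM unitF b0.
Qed.
End GraphOfWord.

(** * Deviation bounds *)

Lemma card_ge_second_moment (R : realFieldType) (S : finType) (Z : S -> R) (T : R) :
  0 <= T -> #|[set s | T <= Z s]%SET|%:R * T ^+ 2 <= \sum_s Z s ^+ 2.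
Proof.
move=> T0; rewrite (bigID (fun s => T <= Z s)) /= -[leLHS]addr0; apply: lerD.
  rewrite mulr_natl -sumr_const [leLHS](eq_bigl (fun s => T <= Z s)).
    by apply: ler_sum => s Ts; rewrite lerXn2r ?nnegrE // (le_trans T0).
  by move=> s; rewrite inE.
by apply: sumr_ge0 => s _; apply: sqr_ge0.
Qed.

(** On the event that [Z] is large, [Z s <= Z s ^+ 2 / (2 * T) + T / 2] for every
    [T > 0]; the value [T = 2 * F1 * F2 * B] makes the quadratic term at most
    half of what the event has to contribute. *)
Lemma paley_zygmund (R : realFieldType) (S : finType) (Z : S -> R) (F1 F2 B : R) :
  0 < F1 -> 0 < F2 -> 0 < B -> (forall s, 0 <= Z s) ->
  #|S|%:R * B <= F1 * \sum_s Z s ->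
  \sum_s Z s ^+ 2 <= #|S|%:R * F2 * B ^+ 2 ->
  #|S|%:R <= 4 * F1 ^+ 2 * F2 * #|[set s | B / (2 * F1) <= Z s]%SET|%:R.
Proof.
move=> F10 F20 B0 Z0 h1 h2; set A := [set s | _]%SET.
set M : R := #|S|%:R in h1 h2 *.
pose T := 2 * F1 * F2 * B.
have T0 : 0 < T by rewrite !mulr_gt0.
have pt s : Z s <= B / (2 * F1) + Z s ^+ 2 / (2 * T) + (s \in A)%:R * (T / 2).
  have Q0 : 0 <= Z s ^+ 2 / (2 * T) by rewrite divr_ge0 ?sqr_ge0 ?mulr_ge0 // ltW.
  have B0' : 0 <= B / (2 * F1) by rewrite divr_ge0 ?mulr_ge0 // ltW.
  rewrite inE; case: (leP (B / (2 * F1)) (Z s)) => [_|/ltW lt]; last by rewrite mul0r addr0 (le_trans lt) // lerDl.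
  rewrite mul1r -addrA; apply: le_trans (_ : Z s ^+ 2 / (2 * T) + T / 2 <= _); last by rewrite lerDr.
  rewrite -(ler_pM2r (_ : 0 < 2 * T)); last by rewrite mulr_gt0.
  rewrite [leRHS]mulrDl divfK ?gt_eqF ?mulr_gt0 // -subr_ge0.
  have -> : Z s ^+ 2 + T / 2 * (2 * T) - Z s * (2 * T) = (Z s - T) ^+ 2 by field.
  exact: sqr_ge0.
have sumZ : \sum_s Z s <= M * (B / (2 * F1)) + (M * F2 * B ^+ 2) / (2 * T) + #|A|%:R * (T / 2).
  apply: le_trans (ler_sum _ (fun s _ => pt s)) _.
  rewrite !big_split /= sumr_const -(mulr_natl (B / _)) -!mulr_suml.
  have -> : \sum_s (s \in A)%:R = #|A|%:R :> R.
    by rewrite -natr_sum -sum1_card [in RHS]big_mkcond; congr _%:R; apply: eq_bigr => s _; case: (s \in A).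
  rewrite lerD2r lerD2l; apply: ler_wpM2r h2.
  by rewrite invr_ge0 mulr_ge0 // ltW.
have : F1 * \sum_s Z s <= F1 * (M * (B / (2 * F1)) + (M * F2 * B ^+ 2) / (2 * T) + #|A|%:R * (T / 2)).
  by apply: (ler_wpM2l (ltW F10)); exact: sumZ.
move=> /(le_trans h1).
have -> : F1 * (M * (B / (2 * F1)) + (M * F2 * B ^+ 2) / (2 * T) + #|A|%:R * (T / 2)) =
   (M * 3 / 4 + F1 ^+ 2 * F2 * #|A|%:R) * B.
  by rewrite /T; field; rewrite !gt_eqF.
rewrite ler_pM2r //; lra.
Qed.

(** Compare with the [D.+1]-st power of [1 + a n / D.+1]. *)
Lemma poly_lt_expR (R : realType) (a C : R) (D : nat) : 0 < a ->
  exists n0 : nat, forall n, (n0 <= n)%N -> C * n.+1%:R ^+ D < expR (a * n%:R).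
Proof.
move=> a0; pose b := Num.min 1 (a / D.+1%:R).
have b0 : 0 < b by rewrite lt_min ltr01 divr_gt0 // ltr0n.
exists (Num.bound (`|C| / b ^+ D.+1)) => n hn.
have x0 : 0 < n.+1%:R :> R by rewrite ltr0n.
have h1 : (b * n.+1%:R) ^+ D.+1 <= expR (a * n%:R).
  have -> : expR (a * n%:R) = expR (a / D.+1%:R * n%:R) ^+ D.+1.
    by rewrite -expRM_natl; congr expR; field; rewrite nat1r pnatr_eq0.
  rewrite lerXn2r ?nnegrE ?expR_ge0 ?mulr_ge0 ?(ltW b0) //.
  apply: le_trans (expR_ge1Dx _).
  rewrite -natr1 mulrDr mulr1 addrC lerD // ?ler_wpM2r // /b ge_min lexx ?orbT //.
apply: lt_le_trans h1; rewrite exprMn [n.+1%:R ^+ D.+1]exprSr -subr_gt0.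
have h2 : `|C| < b ^+ D.+1 * n.+1%:R.
  rewrite mulrC -ltr_pdivrMr ?exprn_gt0 //.
  apply: lt_le_trans (archi_boundP _) _; first by rewrite divr_ge0 // exprn_ge0 // ltW.
  by rewrite ler_nat (leq_trans hn).
rewrite [ltRHS](_ : _ = (b ^+ D.+1 * n.+1%:R - C) * n.+1%:R ^+ D); last ring.
by rewrite mulr_gt0 ?exprn_gt0 // subr_gt0 (le_lt_trans (ler_norm _)).
Qed.

Lemma ln_bethe (R : realType) (n m d q : nat) : (1 < q)%N -> (d.+1 * n = m * 2)%N ->
  ln (bethe R n m d q) = n%:R * ln (q%:R * (1 - 1 / q%:R) `^ (d.+1%:R / 2)).
Proof.
move=> q1 rn.
have q0 : 0 < q%:R :> R by rewrite ltr0n ltnW.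
have q10 : 0 < q%:R - 1 :> R by rewrite subr_gt0 ltr1n.
have E : 1 - 1 / q%:R = (q%:R - 1) / q%:R :> R by field; rewrite gt_eqF.
have p0 : 0 < 1 - 1 / q%:R :> R by rewrite E divr_gt0.
rewrite /bethe ln_div ?posrE ?exprn_gt0 ?mulr_gt0 //.
rewrite !lnXn ?mulr_gt0 // !lnM ?posrE ?powR_gt0 // ln_powR E ln_div ?posrE //.
have rnR : d.+1%:R * n%:R = m%:R * 2 :> R by rewrite -!natrM rn.
rewrite -(mulr_natl _ m) -(mulr_natl _ (n * d)%N) natrM.
have -> : m%:R = (d%:R + 1) * n%:R / 2 :> R by rewrite natr1 rnR mulfK.
by rewrite -[d.+1%:R]natr1; field.
Qed.

(** The polynomial factors of the first moment ([F1]), of the second moment ([F2])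
    and of the probability of being simple ([F3]) are all bounded by [G], which
    is eventually negligible against [expR (azuma_rate / 2 * n)]. *)
Section Deviation.
Variables (R : realType) (n m d q : nat) (nu : {ffun half_edges m -> 'I_n}).
Hypothesis nu_reg : forall x, content nu x = d.+1.
Hypothesis hq : (d.+1 < q)%N.
Hypothesis n1 : (1 < n)%N.
Let r := d.+1.
Let K := bads_bound r.
Hypothesis m_large : (K + (2 + r + r) * r < m)%N.
Notation P := (half_edges m).
Let N : nat := #|{: P}|.
Let F1 : R := n.+1%:R ^+ q * m.+1%:R ^+ (q ^ 2) * expR (imbalance r q)%:R ^+ 2.
Let F2 : R := (N.+1%:R * n.+1%:R) ^+ (q ^ 2).
Let F3 : R := 2 * ((N ^ 2) ^ K)%:R.
Variables (G delta : R).
Hypothesis G1 : 1 <= G.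
Hypothesis F1G : F1 <= G.
Hypothesis F2G : F2 <= G.
Hypothesis F3G : F3 <= G.
Hypothesis delta0 : 0 < delta.
Let c : R := ln 4.
(** The minimiser of the Azuma exponent [2 (lam c)^2 r - lam delta], capped so that
    the one-step estimate [sum_expR_centered] applies. *)
Definition azuma_scale : R := Num.min (2 * c)^-1 (delta / (4 * c ^+ 2 * r%:R)).
(** The exponential rate of all the deviation bounds below. *)
Definition azuma_rate : R := Num.min delta (azuma_scale * delta / 2).
Hypothesis G_small : 4 * G ^+ 3 < expR (azuma_rate / 2 * n%:R).
Let lam := azuma_scale.
Let kap := azuma_rate.
Let B := bethe R n m d q.
Let M : R := (N`!)%:R.
Let Z (s : {perm P}) : R := (word_colorings q (shuffle nu s))%:R.
Let f (s : {perm P}) : R := ln (loose_colorings q [set: 'I_m]%SET (shuffle nu s))%:R.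
Let mu := mean f.
Let b := kap / 2 * n%:R.

Let c0 : 0 < c. Proof. by rewrite ln_gt0 // ltr1n. Qed.
Let q0 : 0 < q%:R :> R. Proof. by rewrite ltr0n (leq_ltn_trans _ hq). Qed.
Let B0 : 0 < B.
Proof.
rewrite divr_gt0 ?exprn_gt0 // mulr_gt0 // subr_gt0 ltr1n.
by apply: leq_ltn_trans hq.
Qed.
Let M0 : 0 < M. Proof. by rewrite ltr0n fact_gt0. Qed.
Let r0 : 0 < r%:R :> R. Proof. by rewrite ltr0n. Qed.
Let nR : 0 < n%:R :> R. Proof. by rewrite ltr0n ltnW. Qed.
Let lam0 : 0 < lam.
Proof. by rewrite lt_min invr_gt0 mulr_gt0 //= divr_gt0 // !mulr_gt0 ?exprn_gt0. Qed.
Let kap0 : 0 < kap. Proof. by rewrite lt_min delta0 /= divr_gt0 // mulr_gt0. Qed.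
Let NE : N%:R = r%:R * n%:R :> R.
Proof. by rewrite -natrM /r (regular_size nu_reg) /N card_prod card_ord card_bool. Qed.
Let G0 : 0 < G. Proof. exact: lt_le_trans G1. Qed.

Let cardS : #|{perm P}| = N`!. Proof. exact: card_perms. Qed.

Let kap_delta : kap <= delta. Proof. by rewrite /kap /azuma_rate ge_min lexx. Qed.

Let b_delta : b <= delta * n%:R.
Proof.
rewrite /b; apply: ler_wpM2r; first exact: ltW.
by apply: le_trans kap_delta; rewrite ler_pdivrMr //; move: kap0; lra.
Qed.

Let tail (l : R) : `|l| = lam ->
  #|[set s | lam * delta * n%:R <= l * (f s - mu)]%SET|%:R <= M * expR (- (kap * n%:R)).
Proof.
move=> lE.
have lip s x y : `|f (s * tperm x y)%g - f s| <= c.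
  by apply: (@ln_loose_colorings_lip _ _ _ _ _ r) => // z; rewrite nu_reg.
have lc : `|l| * c <= 2^-1.
  rewrite lE -ler_pdivlMr // -invfM mulrC.
  by rewrite /lam /azuma_scale ge_min [c * 2]mulrC lexx.
apply: le_trans (shuffle_tail lip (lam * delta * n%:R) lc) _.
rewrite -/N -/M -mulrA; apply: ler_wpM2l; first exact: ltW.
rewrite -expRM_natl -expRD ler_expR exprMn -[l ^+ 2]real_normK ?num_real // lE NE.
have h1 : 4 * c ^+ 2 * r%:R * lam <= delta.
  rewrite mulrC -ler_pdivlMr ?mulr_gt0 ?exprn_gt0 //.
  by rewrite /lam /azuma_scale ge_min lexx orbT.
have h2 : kap <= lam * delta / 2 by rewrite /kap /azuma_rate ge_min lexx orbT.
have h3 : 2 * (lam ^+ 2 * c ^+ 2) * r%:R <= lam * delta / 2.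
  rewrite [leLHS](_ : _ = lam / 2 * (4 * c ^+ 2 * r%:R * lam)); last by field.
  by rewrite [leRHS]mulrAC; apply: ler_wpM2l h1; rewrite divr_ge0 // ltW.
rewrite [leLHS](_ : _ = (2 * (lam ^+ 2 * c ^+ 2) * r%:R - lam * delta) * n%:R); last by ring.
rewrite -[leRHS]mulNr; apply: ler_wpM2r; first exact: ltW.
by lra.
Qed.

Let hb : 1 < expR b.
Proof.
apply: le_lt_trans G_small; have := exprn_ege1 3 G1; lra.
Qed.

Let kapE : expR (- (kap * n%:R)) = (expR b)^-1 ^+ 2.
Proof. by rewrite -expRN -expRM_natl; congr expR; rewrite /b; field. Qed.

Let G3 : 4 * G ^+ 2 * G <= expR b.
Proof. by rewrite -mulrA -exprSr ltW. Qed.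

(** Otherwise the event of the Paley-Zygmund inequality would lie in the upper tail
    [U], which is too small. *)
Let mean_large : ln B - 2 * delta * n%:R < mu.
Proof.
have F10 : 0 < F1 by rewrite !mulr_gt0 ?exprn_gt0 ?expR_gt0 ?ltr0n.
have F20 : 0 < F2 by rewrite exprn_gt0 // mulr_gt0 ?ltr0n.
have pz := @paley_zygmund R {perm P} Z F1 F2 B F10 F20 B0 (fun s => ler0n _ _).
rewrite cardS in pz; have {}pz := pz (first_moment R nu_reg hq n1).
have {}pz := pz (second_moment R nu_reg (ltnW hq) (ltnW n1)).
set A := [set s | _]%SET in pz.
have tl := @tail lam (gtr0_norm lam0).
set U := [set s | _]%SET in tl.
have [s sA sU] : exists2 s, s \in A & s \notin U.
  apply/exists_inP; rewrite -[X in is_true X]negbK negb_exists_in.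
  apply/negP => /forall_inP h.
  have AU : #|A|%:R <= #|U|%:R :> R.
    by rewrite ler_nat; apply: subset_leq_card; apply/fintype.subsetP => s /h; rewrite negbK.
  have : M < M; last by rewrite ltxx.
  apply: le_lt_trans pz _.
  have FF : 4 * F1 ^+ 2 * F2 <= expR b.
    apply: le_trans G3; rewrite ler_pM ?mulr_ge0 ?exprn_ge0 ?(ltW F10) ?(ltW F20) //.
    by rewrite ler_wpM2l // lerXn2r ?nnegrE ?(ltW F10) ?(ltW G0).
  apply: (@le_lt_trans _ _ (expR b * (M * (expR b)^-1 ^+ 2))).
    apply: ler_pM => //; first by rewrite !mulr_ge0 ?exprn_ge0 // ltW.
    by apply: le_trans AU _; rewrite -kapE.
  have -> : expR b * (M * (expR b)^-1 ^+ 2) = M / expR b by field; rewrite gt_eqF ?expR_gt0.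
  by rewrite ltr_pdivrMr ?expR_gt0 // ltr_pMr.
have h1 : ln B - ln (2 * F1) <= f s.
  rewrite -ln_div ?posrE //; last by rewrite mulr_gt0.
  move: sA; rewrite inE => sA; have p0 : 0 < B / (2 * F1) by rewrite divr_gt0 // mulr_gt0.
  have ZL : Z s <= (loose_colorings q [set: 'I_m]%SET (shuffle nu s))%:R.
    by rewrite ler_nat word_le_loose.
  by rewrite ler_ln ?posrE ?(lt_le_trans p0) // (le_trans sA).
have h2 : ln (2 * F1) <= delta * n%:R.
  apply: le_trans b_delta; rewrite -[b]expRK ler_ln ?posrE ?expR_gt0 ?mulr_gt0 //.
  apply: le_trans G3; have : 1 <= G ^+ 2 by rewrite exprn_ege1.
  move: F1G G0; nra.
have h3 : f s < mu + delta * n%:R.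
  move: sU; rewrite inE -ltNge -mulrA ltr_pM2l //; lra.
lra.
Qed.

(** Too many colourings: by [second_moment].  Too few: by the lower tail of [f],
    whose mean is large enough by [mean_large]. *)
Lemma prob_deviation_le :
  prob_regular R r (fun G : {set {set 'I_n}} => 3 * delta <
     `|ln (num_colorings q G)%:R / n%:R - ln (q%:R * (1 - 1 / q%:R) `^ (r%:R / 2))|)
  <= expR (- (azuma_rate / 2 * n%:R)).
Proof.
have rn := regular_size nu_reg.
rewrite (prob_regular_shuffle R _ rn nu_reg).
set D := [set s | _ && _]%SET; set S := [set s : {perm P} | _]%SET.
pose Up := [set s | expR (delta * n%:R) * B <= Z s]%SET.
pose Lo := [set s | lam * delta * n%:R <= - lam * (f s - mu)]%SET.
have q1 : (1 < q)%N by apply: leq_ltn_trans hq.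
have lnB := ln_bethe R q1 rn; rewrite -/B in lnB.
have sub : D \subset Up :|: Lo.
  apply/fintype.subsetP => s; rewrite !inE => /andP[sw].
  set X := ln _; set L := ln (q%:R * _).
  have fE : f s = X by rewrite /X num_colorings_loose.
  move=> dev; apply/orP.
  have : 3 * delta * n%:R < `|X - ln B|.
    rewrite lnB (_ : X - _ = (X / n%:R - L) * n%:R); last by rewrite /L; field; rewrite gt_eqF.
    by rewrite normrM (gtr0_norm nR) ltr_pM2r.
  rewrite lter_normr => /orP[h|h]; [left|right].
    have Z0 : 0 < Z s.
      rewrite /Z -num_colorings_graph_of num_colorings_loose //.
      rewrite ltr0n; apply: (@loose_colorings_gt0 _ _ _ _ _ r) => // z.
      by rewrite content_shuffle nu_reg.
    have pB : 0 < expR (delta * n%:R) * B by rewrite mulr_gt0 ?expR_gt0.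
    rewrite -ler_ln ?posrE // lnM ?posrE ?expR_gt0 // expRK.
    have -> : ln (Z s) = X by rewrite /X num_colorings_graph_of.
    have : 0 < delta * n%:R by rewrite mulr_gt0.
    lra.
  rewrite mulNr -mulrN -mulrA ler_pM2l // fE; have := mean_large; lra.
have cU : #|Up|%:R <= M * G * (expR b)^-1 ^+ 2.
  have T0 : 0 <= expR (delta * n%:R) * B by rewrite mulr_ge0 ?expR_ge0 ?ltW.
  have := le_trans (card_ge_second_moment Z T0) (second_moment R nu_reg (ltnW hq) (ltnW n1)).
  rewrite -/N -/M -/F2 -/B exprMn mulrA -/Up ler_pM2r ?exprn_gt0 // => h.
  have e0 : 0 < expR (delta * n%:R) ^+ 2 by rewrite exprn_gt0 ?expR_gt0.
  move: h; rewrite -ler_pdivlMr // => h; apply: le_trans h _.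
  apply: ler_pM; rewrite ?invr_ge0 ?(ltW e0) ?mulr_ge0 ?(ltW M0) ?exprn_ge0 //.
    by apply: ler_wpM2l F2G; apply: ltW.
  by rewrite exprVn lef_pV2 ?posrE ?exprn_gt0 ?expR_gt0 // lerXn2r ?nnegrE ?expR_ge0 // ler_expR.
have cL : #|Lo|%:R <= M * (expR b)^-1 ^+ 2.
  by rewrite -kapE; apply: tail; rewrite normrN gtr0_norm.
have cS : M <= G * #|S|%:R.
  have nur x : (content nu x <= r)%N by rewrite nu_reg.
  have := card_simple_ge nur m_large; rewrite -/N -/K -/S -(ler_nat R) !natrM mulrA => h.
  by apply: le_trans h _; apply: ler_wpM2r.
have S0 : 0 < #|S|%:R :> R.
  by rewrite -(pmulr_rgt0 _ G0) (lt_le_trans M0).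
rewrite ler_pdivrMr // expRN -/b.
have cD : #|D|%:R <= #|Up|%:R + #|Lo|%:R :> R.
  rewrite -natrD ler_nat; apply: leq_trans (subset_leq_card sub) _; exact: leq_card_setU.
apply: le_trans cD _; apply: le_trans (lerD cU cL) _.
set e := (expR b)^-1 in cU cL *.
have e0 : 0 < e by rewrite invr_gt0 expR_gt0.
have e1 : (G + 1) * G * e <= 1.
  rewrite ler_pdivrMr ?expR_gt0 // mul1r; apply: le_trans G3.
  have g0 := G0; have g1 := ler_wpM2r (ltW G0) G1; have g2 := ler_wpM2r (mulr_ge0 (ltW G0) (ltW G0)) G1.
  rewrite expr2; lra.
have h : M * G * e ^+ 2 + M * e ^+ 2 <= G * #|S|%:R * ((G + 1) * e ^+ 2).
  rewrite [leLHS](_ : _ = M * ((G + 1) * e ^+ 2)); last by ring.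
  by apply: ler_wpM2r cS; rewrite mulr_ge0 ?sqr_ge0 // addr_ge0 // ltW.
apply: le_trans h _.
rewrite [leLHS](_ : _ = (e * #|S|%:R) * ((G + 1) * G * e)); last by ring.
by rewrite ler_piMr // mulr_ge0 ?ltW.
Qed.
End Deviation.

(** * Convergence *)

Lemma azuma_rate_gt0 (R : realType) (d : nat) (delta : R) :
  0 < delta -> 0 < azuma_rate d delta.
Proof.
move=> delta0; have c0 : 0 < ln 4 :> R by rewrite ln_gt0 // ltr1n.
have s0 : 0 < azuma_scale d delta.
  by rewrite lt_min invr_gt0 mulr_gt0 //= divr_gt0 // !mulr_gt0 ?exprn_gt0 // ltr0n.
by rewrite lt_min delta0 /= divr_gt0 // mulr_gt0.
Qed.

Theorem theorem6 (R : realType) (r q : nat)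
    (hr : (1 <= r)%N) (hq : (r + 1 <= q)%N) :
  cvg_whp r
    (fun (n : nat) (G : {set {set 'I_n}}) =>
       ln ((num_colorings q G)%:R : R) / n%:R)
    (ln (q%:R * (1 - 1 / q%:R) `^ (r%:R / 2))).
Proof.
case: r hr hq => // d _; rewrite addn1 => hq delta delta0.
(* One third is spent on the polynomial factors, one on comparing the mean with
   [B], and one on the deviation from the mean. *)
pose delta3 := delta / 3; have delta30 : 0 < delta3 by rewrite divr_gt0.
pose a := azuma_rate d delta3 / 2.
have a0 : 0 < a by rewrite divr_gt0 // azuma_rate_gt0.
pose K := bads_bound d.+1.
pose E : R := expR (imbalance d.+1 q)%:R ^+ 2.
have E1 : 1 <= E by rewrite exprn_ege1 // -expR0 ler_expR.
(* [2 * E * (r (n + 1)) ^+ D] bounds the three polynomial factors. *)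
pose D := (2 * K + 2 * q ^ 2 + q)%N.
have [D1 D2 D3] : [/\ (q + q ^ 2 <= D)%N, (2 * q ^ 2 <= D)%N & (2 * K <= D)%N].
  have le3 (x y z : nat) : [/\ (z + y <= 2 * x + 2 * y + z)%N,
      (2 * y <= 2 * x + 2 * y + z)%N & (2 * x <= 2 * x + 2 * y + z)%N] by split; lia.
  exact: le3.
apply/cvgrPdist_lt => eps eps0; rewrite near_withinE.
have [n1 hn1] := poly_lt_expR (4 * (2 * E * d.+1%:R ^+ D) ^+ 3) (D * 3) a0.
have [n2 hn2] := poly_lt_expR eps^-1 0 a0.
exists (n1 + n2 + 2 * (K + (2 + d.+1 + d.+1) * d.+1) + 2)%N => // n /= hn evn.
have [n1n n2n n_large] : [/\ (n1 <= n)%N, (n2 <= n)%N & (1 < n)%N].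
  by move: hn; move: (2 * _)%N => k; clear => hn; split; lia.
pose m := (d.+1 * n)./2.
have rn : (d.+1 * n = m * 2)%N by rewrite /m muln2 -[LHS]odd_double_half (negPf evn).
have [nu nuP] := exists_pairing_map rn.
have m_large : (K + (2 + d.+1 + d.+1) * d.+1 < m)%N.
  rewrite -(ltn_pmul2r (isT : 0 < 2)%N) -rn mulSn.
  by move: hn; move: (K + _)%N (d * n)%N; lia.
pose y : R := d.+1%:R * n.+1%:R.
have y1 : 1 <= y by rewrite /y -natrM ler1n muln_gt0.
have y0 : 0 <= y by rewrite (le_trans ler01).
have PE : #|{: half_edges m}| = (d.+1 * n)%N by rewrite card_prod card_ord card_bool rn.
have le_y (k : nat) : (k <= d.+1 * n.+1)%N -> k%:R <= y by rewrite /y -natrM ler_nat.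
have xy : n.+1%:R <= y by apply: le_y; rewrite leq_pmull.
have my : m.+1%:R <= y.
  by apply: le_y; rewrite mulnS rn; lia.
have Ny : #|{: half_edges m}|.+1%:R <= y by apply: le_y; rewrite PE mulnS; lia.
have yD k : (k <= D)%N -> y ^+ k <= y ^+ D by move=> kD; apply: ler_weXn2l.
have yX k (z : R) : 0 <= z -> z <= y -> z ^+ k <= y ^+ k.
  by move=> z0 zy; rewrite lerXn2r ?nnegrE.
pose G : R := 2 * E * y ^+ D.
have yD0 : 1 <= y ^+ D by rewrite exprn_ege1.
have E0 : 0 <= E by rewrite (le_trans ler01).
have GE (z : R) : z <= y ^+ D -> 2 * E * z <= G.
  by move=> h; apply: ler_wpM2l h; rewrite mulr_ge0.
have G1 : 1 <= G.
  by apply: le_trans _ (GE 1 yD0); lra.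
have F1G : n.+1%:R ^+ q * m.+1%:R ^+ (q ^ 2) * expR (imbalance d.+1 q)%:R ^+ 2 <= G.
  apply: le_trans _ (GE (y ^+ (q + q ^ 2)) (yD _ _)) => //.
  rewrite -/E [leRHS]mulrAC; apply: ler_wpM2r => //; rewrite exprD.
  have h : n.+1%:R ^+ q * m.+1%:R ^+ (q ^ 2) <= y ^+ q * y ^+ (q ^ 2).
    by apply: ler_pM; rewrite ?exprn_ge0 // yX.
  apply: le_trans h _; have : 0 <= y ^+ q * y ^+ (q ^ 2) by rewrite mulr_ge0 ?exprn_ge0.
  lra.
have F2G : (#|{: half_edges m}|.+1%:R * n.+1%:R) ^+ (q ^ 2) <= G.
  apply: le_trans _ (GE (y ^+ (2 * q ^ 2)) (yD _ _)) => //.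
  have h : (#|{: half_edges m}|.+1%:R * n.+1%:R) ^+ (q ^ 2) <= y ^+ (2 * q ^ 2).
    by rewrite exprM; apply: lerXn2r; rewrite ?nnegrE ?mulr_ge0 ?exprn_ge0 // expr2 ler_pM.
  apply: le_trans h _; have : 0 <= y ^+ (2 * q ^ 2) by rewrite exprn_ge0.
  move: (y ^+ _) => z z0; move: E1; nra.
have F3G : 2 * ((#|{: half_edges m}| ^ 2) ^ K)%:R <= G.
  apply: le_trans _ (GE (y ^+ (2 * K)) (yD _ _)) => //.
  have h : ((#|{: half_edges m}| ^ 2) ^ K)%:R <= y ^+ (2 * K).
    rewrite -expnM natrX; apply: yX => //; apply: le_trans Ny.
    by rewrite ler_nat.
  have : 0 <= y ^+ (2 * K) by rewrite exprn_ge0.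
  by move: h; move: (y ^+ _) (_%:R) => z u uz z0; move: E1; nra.
have Gs : 4 * G ^+ 3 < expR (a * n%:R).
  rewrite (_ : 4 * G ^+ 3 = 4 * (2 * E * d.+1%:R ^+ D) ^+ 3 * n.+1%:R ^+ (D * 3)).
    exact: hn1.
  rewrite /G /y [(d.+1%:R * _) ^+ D]exprMn [2 * E * (_ * _)]mulrA.
  by rewrite [(2 * E * _ * _) ^+ 3]exprMn -[(n.+1%:R ^+ D) ^+ 3]exprM mulrA.
have := prob_deviation_le nuP hq n_large m_large G1 F1G F2G F3G delta30 Gs.
rewrite [3 * delta3]mulrC divfK // => h.
rewrite sub0r normrN ger0_norm; last by rewrite divr_ge0.
apply: le_lt_trans h _; rewrite expRN -[ltRHS]invrK ltf_pV2 ?posrE ?expR_gt0 ?invr_gt0 //.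
by have := hn2 n n2n; rewrite expr0 mulr1.
Qed.
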